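(* First-order model counting (FOMC) is $\#\mathrm{EXP}$-hard under poly-monious reductions even when the domain size is fixed to $2$; that is, the function mapping a first-order sentence $\Psi$ (over an arbitrary relational vocabulary given as part of the input) to the number of structures with domain $\{1,2\}$ satisfying $\Psi$ is $\#\mathrm{EXP}$-hard.
   Context: FOMC is the problem: given a first-order sentence $\Psi$ over a relational vocabulary (which is part of the input) and a number $N$ in unary, compute the number of structures over the vocabulary with domain $\{1,\dots,N\}$ that satisfy $\Psi$. A function $F:\Sigma^*\to\mathbb{N}$ is in $\#\mathrm{EXP}$ if there is a nondeterministic exponential-time Turing machine whose number of accepting runs on $w$ equals $F(w)$ for all $w$. A poly-monious reduction from $F$ to $G$ is a deterministic polynomial-time Turing machine together with a fixed polynomial $p(s_1,\dots,s_t)$ such that on input $w$ it outputs $v_1,\dots,v_t$ with $F(w)=p(G(v_1),\dots,G(v_t))$. $F$ is $\#\mathrm{EXP}$-hard if every $G\in\#\mathrm{EXP}$ poly-moniously reduces to $F$. *)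

(* Defs.v *)
From HB Require Import structures.
From mathcomp Require Import all_boot all_order all_algebra.
From mathcomp Require Import mpoly.
Set Implicit Arguments.
Unset Strict Implicit.
Unset Printing Implicit Defensive.
Import GRing.Theory.

(** * Turing machines *)

Variant move := Left | Stay | Right.

Definition move_code (m : move) : option bool :=
  match m with Left => Some false | Stay => None | Right => Some true end.
Definition move_decode (b : option bool) : move :=
  match b with Some false => Left | None => Stay | Some true => Right end.
Lemma move_codeK : cancel move_code move_decode. Proof. by case. Qed.
HB.instance Definition _ := Finite.copy move (can_type move_codeK).

Definition shift (m : move) (z : int) : int :=
  match m with Left => z - 1 | Stay => z | Right => z + 1 end%R.

(** Nondeterministic Turing machines with input alphabet [A] and finitely many
    two-way infinite tapes, numbered from 0.  [delta q g] is the set of actions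
    allowed in state [q] when [g i] is the symbol read on tape [i]; an action
    gives the new state and, for each tape, the symbol written and the move of
    the head. *)
Record machine (A : finType) := Machine {
  ntapes : nat;
  state : finType;
  symbol : finType;
  blank : symbol;
  letter : A -> symbol;
  letter_inj : injective letter;
  letter_blank : forall a, letter a != blank;
  start : state;
  accept : {set state};
  delta : state -> {ffun 'I_ntapes.+1 -> symbol} ->
          {set state * {ffun 'I_ntapes.+1 -> symbol * move}}
}.

Section Runs.
Variables (A : finType) (M : machine A).

Definition action : finType :=
  (state M * {ffun 'I_(ntapes M).+1 -> symbol M * move})%type.

Record config := Config {
  cstate : state M;
  ctape : 'I_(ntapes M).+1 -> int -> symbol M;
  chead : 'I_(ntapes M).+1 -> int
}.

(** The tape carrying the string [v] in cells 0, ..., |v|-1, and blank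
    elsewhere; [l] embeds the alphabet of [v] in the tape alphabet. *)
Definition string_tape (B : Type) (l : B -> symbol M) (v : seq B) (z : int) :
    symbol M :=
  match z with Posz n => nth (blank M) (map l v) n | Negz _ => blank M end.

Definition init (w : seq A) : config :=
  Config (start M)
    (fun i => if i == ord0 then string_tape (@letter _ M) w
              else fun=> blank M)
    (fun=> 0%R).

Definition enabled (c : config) : {set action} :=
  delta (cstate c) [ffun i => ctape c i (chead c i)].

Definition step (c : config) (a : action) : config :=
  Config a.1
    (fun i z => if z == chead c i then (a.2 i).1 else ctape c i z)
    (fun i => shift (a.2 i).2 (chead c i)).

(** Runs are represented by the sequence of actions performed.  On two-way
    infinite tapes distinct actions lead to distinct configurations, so this is
    the same as counting sequences of configurations. *)
Fixpoint exec (c : config) (s : seq action) : option config :=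
  if s is a :: s' then
    if a \in enabled c then exec (step c a) s' else None
  else Some c.

Definition halted (c : config) : bool := enabled c == set0.

Definition accepting_run (w : seq A) (s : seq action) : bool :=
  if exec (init w) s is Some c then halted c && (cstate c \in accept M)
  else false.

(** Every computation path, whether accepting or not, has at most [T |w|]
    steps. *)
Definition runs_in_time (T : nat -> nat) : Prop :=
  forall (w : seq A) (s : seq action), exec (init w) s -> size s <= T (size w).

Definition deterministic : Prop :=
  forall q g, #|@delta _ M q g| <= 1.

(** The output is read on the last tape (which is the input tape if there is
    only one) when the machine halts. *)
Definition computes (B : finType) (l : B -> symbol M) (f : seq A -> seq B) :
    Prop :=
  forall w : seq A, exists s c,
    [/\ exec (init w) s = Some c, halted c &
        forall z, ctape c ord_max z = string_tape l (f w) z].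

End Runs.

(** Every polynomial in [n] is bounded by some [poly_bound k n]. *)
Definition poly_bound (k n : nat) : nat := n ^ k + k.
Definition exp_bound (k n : nat) : nat := 2 ^ poly_bound k n.

(** * The class #EXP and hardness *)

(** [T.-bseq X] is the finite type of sequences over [X] of length at most
    [T]; by the time bound it contains all runs. *)
Definition in_sharpEXP (A : finType) (F : seq A -> nat) : Prop :=
  exists (M : machine A) (k : nat),
    runs_in_time M (exp_bound k) /\
    forall w : seq A,
      #|[set s : (exp_bound k (size w)).-bseq (action M)
           | accepting_run w s]| = F w.

Definition ptime_computable (A B : finType) (f : seq A -> seq B) : Prop :=
  exists (M : machine A) (l : B -> symbol M) (k : nat),
    [/\ injective l, forall b, l b != blank M, deterministic M,
        runs_in_time M (poly_bound k) & computes l f].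

(** Several strings written on a single tape, each one followed by the
    separator [None]. *)
Definition join (B : Type) (vs : seq (seq B)) : seq (option B) :=
  flatten [seq rcons (map Some v) None | v <- vs].

(** Poly-monious reductions from [F] to [G]; the number [t] of queries and the
    polynomial [p] do not depend on the input. *)
Definition poly_monious_reducible (A B : finType)
    (F : seq A -> nat) (G : seq B -> nat) : Prop :=
  exists (t : nat) (p : {mpoly rat[t]}) (f : seq A -> t.-tuple (seq B)),
    ptime_computable (fun w => join (f w)) /\
    forall w : seq A,
      (F w)%:R%R = p.@[fun i => (G (tnth (f w) i))%:R%R]%R.

Definition sharpEXP_hard (B : finType) (F : seq B -> nat) : Prop :=
  forall (A : finType) (G : seq A -> nat),
    in_sharpEXP G -> poly_monious_reducible G F.

(** * First-order logic *)

(** A relational vocabulary is the list of the arities of its symbols: the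
    symbols of [tau] are 0, ..., size tau - 1, and [r] has arity
    [nth 0 tau r]. *)
Definition vocabulary := seq nat.

Inductive form :=
| Eq (x y : nat)
| Rel (r : nat) (xs : seq nat)
| Neg (f : form)
| And (f g : form)
| Or (f g : form)
| Imp (f g : form)
| All (x : nat) (f : form)
| Ex (x : nat) (f : form).

Fixpoint over (tau : vocabulary) (f : form) : bool :=
  match f with
  | Eq _ _ => true
  | Rel r xs => (r < size tau) && (size xs == nth 0 tau r)
  | Neg g | All _ g | Ex _ g => over tau g
  | And g h | Or g h | Imp g h => over tau g && over tau h
  end.

Fixpoint free_vars (f : form) : seq nat :=
  match f with
  | Eq x y => [:: x; y]
  | Rel _ xs => xs
  | Neg g => free_vars g
  | And g h | Or g h | Imp g h => free_vars g ++ free_vars h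
  | All x g | Ex x g => [seq y <- free_vars g | y != x]
  end.

Definition sentence (tau : vocabulary) (f : form) : bool :=
  over tau f && nilp (free_vars f).

Definition structure (tau : vocabulary) (D : finType) : finType :=
  {dffun forall r : 'I_(size tau), {set (nth 0 tau r).-tuple D}}.

(** Assignments are partial, so that the empty one can serve to evaluate
    sentences in any domain.  For the free variables of the formula they are
    meant to be defined; other values play no role. *)
Definition assign (D : finType) (e : nat -> option D) (x : nat) (d : D) :
    nat -> option D :=
  fun y => if y == x then Some d else e y.

Fixpoint sat (tau : vocabulary) (D : finType) (S : structure tau D)
    (e : nat -> option D) (f : form) : bool :=
  match f with
  | Eq x y => e x == e y
  | Rel r xs =>
      if insub r is Some i then
        [exists t in S i, map Some (tval t) == map e xs]
      else false
  | Neg g => ~~ sat S e g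
  | And g h => sat S e g && sat S e h
  | Or g h => sat S e g || sat S e h
  | Imp g h => sat S e g ==> sat S e h
  | All x g => [forall d : D, sat S (assign e x d) g]
  | Ex x g => [exists d : D, sat S (assign e x d) g]
  end.

Definition model_count (tau : vocabulary) (f : form) (N : nat) : nat :=
  #|[set S : structure tau 'I_N | sat S (fun=> None) f]|.

(** * Encoding of sentences as strings *)

(** Formulas are written in prefix notation, the indices of variables and
    symbols, and the arities, in unary. *)
Variant token :=
  TOne | TSep | TEnd | TEq | TRel | TNeg | TAnd | TOr | TImp | TAll | TEx.

Definition token_code (a : token) : nat :=
  match a with
  | TOne => 0 | TSep => 1 | TEnd => 2 | TEq => 3 | TRel => 4 | TNeg => 5
  | TAnd => 6 | TOr => 7 | TImp => 8 | TAll => 9 | TEx => 10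
  end.
Definition token_ord (a : token) : 'I_11 := inord (token_code a).
Definition token_decode (i : 'I_11) : token :=
  nth TOne [:: TOne; TSep; TEnd; TEq; TRel; TNeg; TAnd; TOr; TImp; TAll; TEx] i.
Lemma token_ordK : cancel token_ord token_decode.
Proof. by case; rewrite /token_decode inordK. Qed.
HB.instance Definition _ := Finite.copy token (can_type token_ordK).

Definition enc_nat (n : nat) : seq token := rcons (nseq n TOne) TSep.
Definition enc_seq (s : seq nat) : seq token :=
  rcons (flatten (map enc_nat s)) TEnd.

Fixpoint enc_form (f : form) : seq token :=
  match f with
  | Eq x y => TEq :: enc_nat x ++ enc_nat y
  | Rel r xs => TRel :: enc_nat r ++ enc_seq xs
  | Neg g => TNeg :: enc_form g
  | And g h => TAnd :: enc_form g ++ enc_form h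
  | Or g h => TOr :: enc_form g ++ enc_form h
  | Imp g h => TImp :: enc_form g ++ enc_form h
  | All x g => TAll :: enc_nat x ++ enc_form g
  | Ex x g => TEx :: enc_nat x ++ enc_form g
  end.

Definition encode (u : vocabulary * form) : seq token :=
  enc_seq u.1 ++ enc_form u.2.

(** Parsers return the object read and the remaining string. *)
Fixpoint dec_nat (w : seq token) : option (nat * seq token) :=
  match w with
  | TOne :: w' => omap (fun u => (u.1.+1, u.2)) (dec_nat w')
  | TSep :: w' => Some (0, w')
  | _ => None
  end.

Fixpoint dec_seq_rec (n : nat) (w : seq token) :
    option (seq nat * seq token) :=
  match n, w with
  | n'.+1, TEnd :: w' => Some ([::], w')
  | n'.+1, _ =>
      obind (fun u => omap (fun v => (u.1 :: v.1, v.2)) (dec_seq_rec n' u.2))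
        (dec_nat w)
  | _, _ => None
  end.
Definition dec_seq (w : seq token) := dec_seq_rec (size w) w.

Fixpoint dec_form_rec (n : nat) (w : seq token) : option (form * seq token) :=
  if n isn't n'.+1 then None else
  let un op w' := omap (fun u => (op u.1, u.2)) (dec_form_rec n' w') in
  let bin op w' :=
    obind (fun u => un (op u.1) u.2) (dec_form_rec n' w') in
  let quant op w' := obind (fun u => un (op u.1) u.2) (dec_nat w') in
  match w with
  | TEq :: w' =>
      obind (fun u => omap (fun v => (Eq u.1 v.1, v.2)) (dec_nat u.2))
        (dec_nat w')
  | TRel :: w' =>
      obind (fun u => omap (fun v => (Rel u.1 v.1, v.2)) (dec_seq u.2))
        (dec_nat w')
  | TNeg :: w' => un Neg w'
  | TAnd :: w' => bin And w'
  | TOr :: w' => bin Or w'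
  | TImp :: w' => bin Imp w'
  | TAll :: w' => quant All w'
  | TEx :: w' => quant Ex w'
  | _ => None
  end.
Definition dec_form (w : seq token) := dec_form_rec (size w) w.

Definition decode (w : seq token) : option (vocabulary * form) :=
  if dec_seq w is Some (tau, w') then
    if dec_form w' is Some (f, [::]) then Some (tau, f) else None
  else None.

Lemma dec_nat_enc n w : dec_nat (enc_nat n ++ w) = Some (n, w).
Proof. by elim: n => //= n; rewrite /enc_nat => ->. Qed.

Lemma dec_natP w n w' : dec_nat w = Some (n, w') -> w = enc_nat n ++ w'.
Proof.
elim: w n => [|[] w IH] //= n; last by case=> <- <-.
by case E: (dec_nat w) => [[m v]|] //= [<- Ev]; rewrite (IH m) // E Ev.
Qed.

Lemma dec_seq_rec_enc n s w : size (enc_seq s ++ w) <= n ->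
  dec_seq_rec n (enc_seq s ++ w) = Some (s, w).
Proof.
have Ecat x t : enc_seq (x :: t) ++ w = enc_nat x ++ (enc_seq t ++ w).
  by rewrite /enc_seq /= rcons_cat -catA.
elim: s n => [|x s IH] [|n] //; rewrite Ecat size_cat size_rcons // addSn ltnS.
move=> le_n; have {}IH := IH n (leq_trans (leq_addl _ _) le_n).
have E := dec_nat_enc x (enc_seq s ++ w).
by case: x {le_n} E => [|x] E; rewrite /= ?IH //; rewrite /= in E; rewrite E /= IH.
Qed.

Lemma dec_seq_enc s w : dec_seq (enc_seq s ++ w) = Some (s, w).
Proof. exact: dec_seq_rec_enc. Qed.

Lemma dec_seq_recP n w s w' :
  dec_seq_rec n w = Some (s, w') -> w = enc_seq s ++ w'.
Proof.
elim: n w s w' => [|n IH] w s w' //.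
have IHn : obind (fun u => omap (fun v => (u.1 :: v.1, v.2))
    (dec_seq_rec n u.2)) (dec_nat w) = Some (s, w') -> w = enc_seq s ++ w'.
  case E: (dec_nat w) => [[m v]|] //=; rewrite (dec_natP E).
  case E': (dec_seq_rec n v) => [[s' v']|] //= [<- <-].
  by rewrite (IH _ _ _ E') /enc_seq /= rcons_cat -catA.
by case: w IHn => [|[] w] IHn //=; case=> <- <-.
Qed.

Lemma dec_form_rec_enc n f w : size (enc_form f ++ w) <= n ->
  dec_form_rec n (enc_form f ++ w) = Some (f, w).
Proof.
have szr (a b : seq token) m : size (a ++ b) <= m -> size b <= m.
  by rewrite size_cat; apply: leq_trans; apply: leq_addl.
elim: f n w => [x y|r xs|f IH|f IHf g IHg|f IHf g IHg|f IHf g IHg|x f IH|x f IH]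
  [|n] w //=; rewrite ltnS -?catA => le_n.
- by rewrite dec_nat_enc /= dec_nat_enc.
- by rewrite dec_nat_enc /= dec_seq_enc.
- by rewrite IH.
- by rewrite IHf //= IHg //; apply: szr le_n.
- by rewrite IHf //= IHg //; apply: szr le_n.
- by rewrite IHf //= IHg //; apply: szr le_n.
- by rewrite dec_nat_enc /= IH //; apply: szr le_n.
- by rewrite dec_nat_enc /= IH //; apply: szr le_n.
Qed.

Lemma dec_form_recP n w f w' :
  dec_form_rec n w = Some (f, w') -> w = enc_form f ++ w'.
Proof.
elim: n w f w' => [|n IH] [|[] w] //= f w'.
- case E: (dec_nat w) => [[x v]|] //=; case E': (dec_nat v) => [[y u]|] //=.
  by case=> <- <- /=; rewrite (dec_natP E) (dec_natP E') catA.
- case E: (dec_nat w) => [[x v]|] //=; case E': (dec_seq v) => [[y u]|] //=.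
  by case=> <- <- /=; rewrite (dec_natP E) (dec_seq_recP E') catA.
- by case E: (dec_form_rec n w) => [[g v]|] //= [<- <-] /=; rewrite (IH _ _ _ E).
- case E: (dec_form_rec n w) => [[g v]|] //=.
  case E': (dec_form_rec n v) => [[h u]|] //= [<- <-] /=.
  by rewrite (IH _ _ _ E) (IH _ _ _ E') catA.
- case E: (dec_form_rec n w) => [[g v]|] //=.
  case E': (dec_form_rec n v) => [[h u]|] //= [<- <-] /=.
  by rewrite (IH _ _ _ E) (IH _ _ _ E') catA.
- case E: (dec_form_rec n w) => [[g v]|] //=.
  case E': (dec_form_rec n v) => [[h u]|] //= [<- <-] /=.
  by rewrite (IH _ _ _ E) (IH _ _ _ E') catA.
- case E: (dec_nat w) => [[x v]|] //=.
  case E': (dec_form_rec n v) => [[h u]|] //= [<- <-] /=.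
  by rewrite (dec_natP E) (IH _ _ _ E') catA.
- case E: (dec_nat w) => [[x v]|] //=.
  case E': (dec_form_rec n v) => [[h u]|] //= [<- <-] /=.
  by rewrite (dec_natP E) (IH _ _ _ E') catA.
Qed.

Lemma encodeK : pcancel encode decode.
Proof.
case=> tau f; rewrite /decode /encode dec_seq_enc /=.
by have := @dec_form_rec_enc _ f [::] (leqnn _); rewrite !cats0 /dec_form => ->.
Qed.

Lemma decodeK : ocancel decode encode.
Proof.
move=> w; rewrite /decode; case E: (dec_seq w) => [[tau v]|] //=.
case E': (dec_form v) => [[f [|a u]]|] //=.
by rewrite /encode /= (dec_seq_recP E) (dec_form_recP E') cats0.
Qed.

(** First-order model counting over the domain ['I_N]; strings that do not
    encode a sentence over a vocabulary have value 0. *)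
Definition fomc (N : nat) (w : seq token) : nat :=
  if decode w is Some (tau, f) then
    if sentence tau f then model_count tau f N else 0
  else 0.

(* Main.v *)
(** Accepting runs of a machine on an input [w] of length [n] are
    in bijection with tableaux indexed by (time, position) in
    [Z/2^m x Z/2^m], where [m = n^k + k + n + 3]: the conditions on a tableau
    are local (cells at positions p - 1, p, p + 1 at time t and p at time
    t + 1), apart from the first row, which is determined by [w].  Over a
    domain of two elements, a unary relation that holds for exactly one element
    lets [m] variables denote the bits of a number, and a tableau is a family of
    relations of arity [2m], one for each possible content of a cell.  A
    sentence of size polynomial in [n] describes the valid tableaux, and has
    twice as many models as there are accepting runs, because of the choice of
    the element representing the bit 1; hence the polynomial [X / 2].

    For the polynomial-time computability, the sentence is the output of loop
    programs with bounded nesting whose registers contain [n] and [m]; these are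
    compiled to structured programs acting on tapes, and those to a machine. *)

From HB Require Import structures.
From mathcomp Require Import all_boot all_order all_algebra.
From mathcomp Require Import mpoly.
From mathcomp Require Import zify.
From Stdlib Require Import FunctionalExtensionality.
Require Import Defs.
Set Implicit Arguments.
Unset Strict Implicit.
Unset Printing Implicit Defensive.
Import GRing.Theory Num.Theory.

(** * Structured programs for multi-tape machines *)

(** Counting requires that a run have exactly one tableau. Therefore each cell of a row carries a
    copy of the state, of the symbols read and of the next action, so that a nondeterministic choice
    cannot be made differently at two places of the row; and a halted configuration is repeated to
    fill the remaining rows. Numbers modulo 2^m have a total successor, so that the ends of a finite
    strip of tape need no special case; the price is that integer positions are known only up to
    congruence, and m must be so large that heads never wrap around.

    Writing down the sentence is easy because prefix notation has no closing tokens: conjunctions,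
    quantifier blocks and the description of the input are nested to the right, so that their codes
    are plain concatenations. In particular each input letter contributes a text that depends only
    on this letter and on the input length. Once the length is known, one pass over the input
    suffices. *)

Section Commands.
Variables (I S : finType).

Definition tape := ((int -> S) * int)%type.
Definition tapes := I -> tape.
Definition upd (s : tapes) (i : I) (t : tape) : tapes :=
  fun j => if j == i then t else s j.
Definition read (t : tape) : S := t.1 t.2.
Definition act (a : S * move) (t : tape) : tape :=
  (fun z => if z == t.2 then a.1 else t.1 z, shift a.2 t.2).

Lemma updE s i t : upd s i t i = t. Proof. by rewrite /upd eqxx. Qed.
Lemma updN s i j t : j != i -> upd s i t j = s j.
Proof. by rewrite /upd => /negbTE->. Qed.
Lemma upd_id s i t : s i = t -> upd s i t = s.
Proof.
by move=> <-; apply: functional_extensionality => j; rewrite /upd;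
  case: eqP => // ->.
Qed.
Lemma upd_upd s i t t' : upd (upd s i t) i t' = upd s i t'.
Proof. by apply: functional_extensionality => j; rewrite /upd; case: eqP. Qed.
Lemma act_id t : act (read t, Stay) t = t.
Proof.
case: t => t h; rewrite /act /read /=; congr pair.
by apply: functional_extensionality => z; case: eqP => // ->.
Qed.

Inductive cmd :=
| Prim (i : I) (f : S -> S * move)
| Sq (c d : cmd)
| While (i : I) (p : pred S) (c : cmd)
| If (i : I) (p : pred S) (c d : cmd).

Inductive runs : cmd -> tapes -> nat -> tapes -> Prop :=
| RunPrim i f s : runs (Prim i f) s 1 (upd s i (act (f (read (s i))) (s i)))
| RunSq c d s n s1 n' s2 :
    runs c s n s1 -> runs d s1 n' s2 -> runs (Sq c d) s (n + n') s2
| RunDone i (p : pred S) c s : ~~ p (read (s i)) -> runs (While i p c) s 1 s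
| RunLoop i (p : pred S) c s n s1 n' s2 :
    p (read (s i)) -> runs c s n s1 -> runs (While i p c) s1 n' s2 ->
    runs (While i p c) s (n + n').+1 s2
| RunIf i (p : pred S) c d s n s1 :
    runs (if p (read (s i)) then c else d) s n s1 ->
    runs (If i p c d) s n.+1 s1.

(** The points of a command from which a machine step is made. The extra [None] of [While] and [If]
    is the test, which takes a step of its own. *)
Fixpoint ctl (c : cmd) : finType :=
  match c with
  | Prim _ _ => unit
  | Sq c d => (ctl c + ctl d)%type
  | While _ _ c => option (ctl c)
  | If _ _ c d => option (ctl c + ctl d)
  end.

Fixpoint entry (c : cmd) : ctl c :=
  match c with
  | Prim _ _ => tt
  | Sq c d => inl (entry c)
  | While _ _ c => None
  | If _ _ c d => None
  end.

Definition obs := {ffun I -> S}.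
Definition acts := {ffun I -> S * move}.
Definition idle (g : obs) : acts := [ffun i => (g i, Stay)].

(** The control state [None] means that the command has been completed. *)
Fixpoint next (c : cmd) : ctl c -> obs -> option (ctl c) * acts :=
  match c with
  | Prim i f => fun _ g =>
      (None, [ffun j => if j == i then f (g j) else (g j, Stay)])
  | Sq c d => fun q g =>
      match q with
      | inl q => let: (q', a) := next q g in
                 (Some (if q' is Some q'' then inl q'' else inr (entry d)), a)
      | inr q => let: (q', a) := next q g in (omap inr q', a)
      end
  | While i p c => fun q g =>
      if q is Some q then let: (q', a) := next q g in (Some q', a)
      else (if p (g i) then Some (Some (entry c)) else None, idle g)
  | If i p c d => fun q g =>
      match q with
      | Some (inl q) => let: (q', a) := next q g in (omap (Some \o inl) q', a)
      | Some (inr q) => let: (q', a) := next q g in (omap (Some \o inr) q', a)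
      | None =>
          (Some (Some (if p (g i) then inl (entry c) else inr (entry d))),
           idle g)
      end
  end.

Definition look (s : tapes) : obs := [ffun i => read (s i)].
Definition perform (a : acts) (s : tapes) : tapes := fun i => act (a i) (s i).

Lemma perform_idle s : perform (idle (look s)) s = s.
Proof.
by apply: functional_extensionality => i; rewrite /perform !ffunE act_id.
Qed.

Inductive path (c : cmd) : nat -> option (ctl c) -> tapes ->
    option (ctl c) -> tapes -> Prop :=
| PathNil q s : path 0 q s q s
| PathCons n q s q' s' q1 a : next q (look s) = (q1, a) ->
    path n q1 (perform a s) q' s' -> path n.+1 (Some q) s q' s'.

Lemma path_cat c n n' q s q1 s1 q2 s2 :
  @path c n q s q1 s1 -> path n' q1 s1 q2 s2 -> path (n + n') q s q2 s2.
Proof.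
by elim=> // {}n {}q {}s q' s' q3 a E _ IH P; apply: PathCons E (IH P).
Qed.

(** Runs a subcommand inside a compound one: [h] relabels its control points and sends its
    completion to whatever follows in the compound command. *)
Lemma path_lift c d (h : option (ctl c) -> option (ctl d)) :
  (forall q g, exists2 q', h (Some q) = Some q' &
     next q' g = (h (next q g).1, (next q g).2)) ->
  forall n q s q' s', path n q s q' s' -> path n (h q) s (h q') s'.
Proof.
move=> hP n q s q' s'; elim=> [*|{}n {}q {}s {}q' {}s' q1 a E _ IH].
  exact: PathNil.
by have [q2 -> E2] := hP q (look s); apply: PathCons IH; rewrite E2 E.
Qed.

Lemma path1 (c : cmd) q s q' a : next q (look s) = (q', a) ->
  @path c 1 (Some q) s q' (perform a s).
Proof. by move=> E; apply: PathCons E (PathNil _ _). Qed.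

(** Step counts agree exactly: [runs] charges one step for each primitive and each test, and passing
    to the next subcommand is part of the last step of the previous one. *)
Lemma runs_path c s n s' : runs c s n s' -> path n (Some (entry c)) s None s'.
Proof.
elim=> {c s n s'}.
- move=> i f s; set s' := upd _ _ _; pose a : acts := [ffun j =>
    if j == i then f (look s j) else (look s j, Stay)].
  have -> : s' = perform a s.
    apply: functional_extensionality => j; rewrite /perform /a /s' /upd !ffunE.
    by case: eqP => [->|_] //; rewrite act_id.
  exact: path1.
- move=> c d s n s1 n' s2 _ IHc _ IHd.
  have Pc := path_lift (d := Sq c d) (h := fun q => Some
    (if q is Some q then inl q else inr (entry d))) _ IHc.
  have Pd := path_lift (d := Sq c d) (h := omap inr) _ IHd.
  apply: path_cat (Pc _) (Pd _) => q g.
    by exists (inl q) => //=; case: (next q g).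
  by exists (inr q) => //=; case: (next q g).
- move=> i p c s Np; rewrite -{2}[s]perform_idle; apply: path1 => /=.
  by rewrite ffunE (negbTE Np).
- move=> i p c s n s1 n' s2 p_s _ IHc _ IHw; rewrite -addSn.
  apply: path_cat IHw; apply: (@PathCons (While i p c) _ None _ _ _
    (Some (Some (entry c))) (idle (look s))); first by rewrite /= ffunE p_s.
  rewrite perform_idle.
  apply: (path_lift (d := While i p c) (h := Some) _ IHc) => q g.
  by exists (Some q) => //=; case: (next q g).
- move=> i p c d s n s1 _ IH; pose q0 := if p (read (s i))
    then Some (inl (entry c)) else Some (inr (entry d)) : ctl (If i p c d).
  apply: (@PathCons (If i p c d) _ None _ _ _ (Some q0) (idle (look s))).
    by rewrite /= /q0 ffunE; case: ifP.
  rewrite perform_idle /q0; case: ifP IH => _ IH.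
    apply: (path_lift (d := If i p c d) (h := omap (Some \o inl)) _ IH) => q g.
    by exists (Some (inl q)) => //=; case: (next q g).
  apply: (path_lift (d := If i p c d) (h := omap (Some \o inr)) _ IH) => q g.
  by exists (Some (inr q)) => //=; case: (next q g).
Qed.

End Commands.

(** * Machines executing commands *)

Definition string_on (S : Type) (blank : S) (u : seq S) (z : int) : S :=
  if z is Posz n then nth blank u n else blank.

Section Machines.
Variables (A S : finType) (blank : S) (letter : A -> S).
Hypotheses (letter_inj : injective letter)
  (letter_blank : forall a, letter a != blank).
Variables (nt : nat) (c : cmd 'I_nt.+1 S).

Definition cmd_delta (q : option (ctl c)) (g : {ffun 'I_nt.+1 -> S}) :
    {set option (ctl c) * {ffun 'I_nt.+1 -> S * move}} :=
  if q is Some q then [set next q g] else set0.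

(** [None] has no transitions, so that the machine halts exactly when the command is completed. *)
Definition cmd_machine : machine A :=
  Machine letter_inj letter_blank (Some (entry c)) set0 cmd_delta.

Lemma cmd_machine_deterministic : deterministic cmd_machine.
Proof. by case=> [q|] g; rewrite /= ?cards1 ?cards0. Qed.

Definition input_tapes (w : seq A) : tapes 'I_nt.+1 S := fun i =>
  (if i == ord0 then string_on blank (map letter w) else fun=> blank, 0%R).

Definition tapes_of (C : config cmd_machine) : tapes 'I_nt.+1 S :=
  fun i => (ctape C i, chead C i).

Lemma path_exec n (C : config cmd_machine) q s q' s' :
  path n q s q' s' -> cstate C = q -> tapes_of C = s ->
  exists u C', [/\ exec C u = Some C', size u = n, cstate C' = q' &
    tapes_of C' = s'].
Proof.
move=> P; elim: P C => {n q s q' s'} [q s|n q s q' s' q1 a E _ IH] C Eq Es.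
  by exists [::], C.
case: (IH (step C (q1, a : {ffun 'I_(ntapes cmd_machine).+1 -> S * move})));
  [by [] | by rewrite -Es | move=> u [C' [Eu <- <- <-]]].
exists ((q1, a) :: u), C'; split=> //=; rewrite -Eu.
suff -> : (q1, a) \in enabled C by [].
rewrite /enabled /= /cmd_delta Eq inE -E; apply/eqP; congr (next q _).
by apply/ffunP=> i; rewrite !ffunE -Es.
Qed.
End Machines.

(** Turns one halting run into a time bound for all partial runs: with at most one action available
    each time, every partial run is a prefix of the halting one. *)
Lemma exec_deterministic (A : finType) (M : machine A) (C C' : config M) u v :
  deterministic M -> exec C u = Some C' -> halted C' -> exec C v ->
  size v <= size u.
Proof.
move=> detM; elim: u v C => [|a u IH] [|b v] C //=.
  by case=> <- /eqP->; rewrite inE.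
case: ifP => // Ca Eu hC'; case: ifP => // Cb Ev; rewrite ltnS.
suff Eab : a = b by apply: IH Eu hC' _; rewrite Eab.
apply/eqP; have := detM (cstate C) [ffun i => ctape C i (chead C i)].
by rewrite -/(enabled C) => /card_le1_eqP le1; apply/eqP/le1.
Qed.

Lemma cmd_ptime (A B S : finType) (blank : S) (letter : A -> S) (l : B -> S)
    (nt : nat) (c : cmd 'I_nt.+1 S) (k : nat) (f : seq A -> seq B) :
  injective letter -> (forall a, letter a != blank) ->
  injective l -> (forall b, l b != blank) ->
  (forall w, exists n s, [/\ n <= poly_bound k (size w),
     runs c (@input_tapes _ _ blank letter nt w) n s &
     (s ord_max).1 = string_on blank (map l (f w))]) ->
  ptime_computable f.
Proof.
move=> li lb l'i l'b H; exists (cmd_machine li lb c), l, k.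
have run w : exists u C, [/\ exec (init (cmd_machine li lb c) w) u = Some C,
    halted C, size u <= poly_bound k (size w) &
    ctape C ord_max = string_on blank (map l (f w))].
  have [n [s [le_n /runs_path P Es]]] := H w.
  have E0 : tapes_of (init (cmd_machine li lb c) w) = @input_tapes _ _ blank
    letter nt w.
    apply: functional_extensionality => i; rewrite /tapes_of /input_tapes /=.
    by case: eqP.
  have [u [C [Eu szu qC tC]]] := path_exec (C := init (cmd_machine li lb c) w) P
    erefl E0.
  exists u, C; split; rewrite ?szu //; first by rewrite /halted /enabled qC.
  by rewrite -Es -tC.
split=> //; first exact: cmd_machine_deterministic.
  move=> w v; have [u [C [Eu hC le_u _]]] := run w => /(exec_deterministic
    (@cmd_machine_deterministic _ _ _ _ li lb _ c) Eu hC) le_v.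
  exact: leq_trans le_u.
move=> w; have [u [C [Eu hC _ EC]]] := run w; exists u, C; split=> // z.
by rewrite EC; case: z.
Qed.

(** * Loop programs producing strings *)

Section Loops.
Variables (I S : finType) (blank : S).
Notation cmd := (cmd I S).
Notation tapes := (tapes I S).
Notation str := (string_on blank).

(** Without blanks inside, the ends of a string can be found by looking for a blank. *)
Definition solid (u : seq S) := all (fun c => c != blank) u.

Definition skip i : cmd := Prim i (fun c => (c, Stay)).
Definition left i : cmd := Prim i (fun c => (c, Left)).
Definition right i : cmd := Prim i (fun c => (c, Right)).
Definition put i c : cmd := Prim i (fun=> (c, Right)).
Definition wind i : cmd := While i (fun c => c != blank) (right i).
Definition scan_left i : cmd := While i (fun c => c != blank) (left i).
(** The first move to the left is there because the head may stand on the blank after the string,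
    where the scan would stop at once. *)
Definition rewind i : cmd := Sq (left i) (Sq (scan_left i) (right i)).
Definition clear i : cmd :=
  Sq (wind i) (Sq (left i)
    (Sq (While i (fun c => c != blank) (Prim i (fun=> (blank, Left))))
        (right i))).

Lemma runs_prim i f (s : tapes) (t t' : tape S) :
  s i = t -> act (f (read t)) t = t' ->
  runs (Prim i f) s 1 (upd s i t').
Proof. by move=> <- <-; apply: RunPrim. Qed.

Lemma runs_cast (c : cmd) s n n' s1 s2 : runs c s n s1 -> n = n' -> s1 = s2 ->
  runs c s n' s2.
Proof. by move=> H <- <-. Qed.

Lemma act_keep (t : tape S) m : act (read t, m) t = (t.1, shift m t.2).
Proof.
case: t => t h; rewrite /act /read /=; congr pair.
by apply: functional_extensionality => z; case: eqP => // ->.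
Qed.

Lemma act_put u c :
  act (c, Right) (str u, Posz (size u)) = (str (rcons u c), Posz (size u).+1).
Proof.
rewrite /act /=; congr pair; last by lia.
apply: functional_extensionality => -[z|z] //=.
rewrite nth_rcons eqz_nat; case: (ltngtP z (size u)) => // lt_z.
by rewrite nth_default // ltnW.
Qed.

Lemma act_erase u c :
  act (blank, Left) (str (rcons u c), Posz (size u)) =
  (str u, Posz (size u) - 1)%R.
Proof.
rewrite /act /=; congr pair; apply: functional_extensionality => -[z|z] //=.
rewrite nth_rcons eqz_nat; case: (ltngtP z (size u)) => // [lt_z|->].
  by rewrite nth_default // ltnW.
by rewrite nth_default.
Qed.

Lemma solid_nth u h : solid u -> (nth blank u h != blank) = (h < size u).
Proof.
move=> su; case: ltnP => lt_h; last by rewrite nth_default // eqxx.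
exact: (allP su) (mem_nth _ lt_h).
Qed.

Lemma runs_right i (s : tapes) u h : s i = (str u, Posz h) ->
  runs (right i) s 1 (upd s i (str u, Posz h.+1)).
Proof.
by move=> E; apply: runs_prim E _; rewrite act_keep /=; congr pair; lia.
Qed.

Lemma runs_put i (s : tapes) u c : s i = (str u, Posz (size u)) ->
  runs (put i c) s 1 (upd s i (str (rcons u c), Posz (size (rcons u c)))).
Proof. by move=> E; apply: runs_prim E _; rewrite act_put size_rcons. Qed.

Lemma runs_wind i (s : tapes) u h : solid u -> h <= size u -> s i = (str u, Posz
  h) ->
  runs (wind i) s (size u - h).*2.+1 (upd s i (str u, Posz (size u))).
Proof.
move=> su; move def_k: (size u - h) => k;
  elim: k h s def_k => [|k IH] h s Ek le_h E.
  have -> : Posz (size u) = Posz h by lia.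
  rewrite upd_id //; apply: RunDone; rewrite E /read /= solid_nth //; lia.
have := IH h.+1 (upd s i (str u, Posz h.+1)); rewrite updE upd_upd => {}IH.
apply: runs_cast (_ : runs _ s (1 + k.*2.+1).+1 _) _ erefl; last by lia.
apply: RunLoop (runs_right E) (IH _ _ _) => //; try lia.
rewrite E /read /= solid_nth //; lia.
Qed.

Lemma runs_scan_left i (s : tapes) u h : solid u -> h <= size u ->
  s i = (str u, Posz h - 1)%R ->
  runs (scan_left i) s h.*2.+1 (upd s i (str u, (-1)%R)).
Proof.
move=> su; elim: h s => [|h IH] s le_h E.
  by rewrite upd_id //; apply: RunDone; rewrite E /read /= eqxx.
have {}E : s i = (str u, Posz h) by rewrite E; congr pair; lia.
have := IH (upd s i (str u, (Posz h - 1)%R)); rewrite updE upd_upd => {}IH.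
apply: runs_cast (_ : runs _ s (1 + h.*2.+1).+1 _) _ erefl; last by lia.
apply: RunLoop (IH _ erefl); last by lia.
  by rewrite E /read /= solid_nth.
by apply: runs_prim E _; rewrite act_keep.
Qed.

Lemma runs_rewind i (s : tapes) u h : solid u -> h <= size u -> s i = (str u,
  Posz h) ->
  runs (rewind i) s h.*2.+3 (upd s i (str u, Posz 0)).
Proof.
move=> su le_h E; apply: runs_cast (RunSq (runs_prim E _) (RunSq
  (runs_scan_left su le_h (updE (I := I) (S := S) _ _ _)) (runs_prim (updE (I :=
    I) (S := S) _ _ _) _))) _ _;
  rewrite ?act_keep ?upd_upd //; lia.
Qed.

Lemma runs_erase i (s : tapes) u : solid u -> s i = (str u, Posz (size u) - 1)%R
  ->
  runs (While i (fun c => c != blank) (Prim i (fun=> (blank, Left)))) s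
    (size u).*2.+1 (upd s i (str [::], (-1)%R)).
Proof.
elim/last_ind: u s => [|u c IH] s.
  by move=> _ E; rewrite upd_id //; apply: RunDone; rewrite E /read /= eqxx.
rewrite /solid all_rcons size_rcons => /andP[c_nb su] E.
have {}E : s i = (str (rcons u c), Posz (size u)) by rewrite E; congr pair; lia.
have := IH (upd s i (str u, (Posz (size u) - 1)%R)) su.
rewrite updE upd_upd => {}IH.
apply: runs_cast (_ : runs _ s (1 + (size u).*2.+1).+1 _) _ erefl; last by lia.
apply: RunLoop (IH erefl).
  by rewrite E /read /= nth_rcons ltnn eqxx.
by apply: runs_prim E _; rewrite act_erase.
Qed.

Lemma runs_clear i (s : tapes) u : solid u -> s i = (str u, Posz 0) ->
  runs (clear i) s (4 * size u + 4) (upd s i (str [::], Posz 0)).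
Proof.
move=> su E; apply: runs_cast (RunSq (runs_wind su _ E) (RunSq
  (runs_prim (updE (I := I) (S := S) _ _ _) _) (RunSq (runs_erase su (updE (I :=
    I) (S := S) _ _ _))
  (runs_prim (updE (I := I) (S := S) _ _ _) _)))) _ _;
    rewrite ?act_keep ?upd_upd //; lia.
Qed.

Variable mark : S.
Hypothesis mark_blank : mark != blank.

Definition incr i : cmd := Sq (wind i) (Sq (put i mark) (rewind i)).

Definition marks v := nseq v mark.
Lemma solid_marks v : solid (marks v).
Proof. by rewrite /solid all_nseq mark_blank orbT. Qed.
Lemma marksS v : rcons (marks v) mark = marks v.+1.
Proof. by elim: v => //= v ->. Qed.

Lemma runs_incr i (s : tapes) v : s i = (str (marks v), Posz 0) ->
  runs (incr i) s (4 * v + 7) (upd s i (str (marks v.+1), Posz 0)).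
Proof.
move=> E; apply: runs_cast (RunSq (runs_wind (solid_marks v) _ E) (RunSq
  (runs_put _ (updE (I := I) (S := S) _ _ _)) (runs_rewind (solid_marks v.+1)
    (leqnn _) _))) _ _.
- by [].
- by rewrite updE marksS.
- by rewrite !size_nseq; lia.
- by rewrite !upd_upd.
Qed.

(** Registers are tapes holding numbers in unary; [For x r P] executes [P] for
    [x] = 0, ..., r - 1. *)
Inductive prog :=
| Emit (u : seq S)
| Cat (P Q : prog)
| For (x r : I) (P : prog).

Definition put_reg (e : I -> nat) x v y := if y == x then v else e y.

Fixpoint den (P : prog) (e : I -> nat) : seq S :=
  match P with
  | Emit u => u
  | Cat P Q => den P e ++ den Q e
  | For x r P => flatten [seq den P (put_reg e x v) | v <- iota 0 (e r)]
  end.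

Fixpoint regs (P : prog) : seq I :=
  match P with
  | Emit _ => [::]
  | Cat P Q => regs P ++ regs Q
  | For x r P => [:: x, r & regs P]
  end.

Fixpoint bound_regs (P : prog) : seq I :=
  match P with
  | Emit _ => [::]
  | Cat P Q => bound_regs P ++ bound_regs Q
  | For x r P => x :: bound_regs P
  end.

(** In the compiled program, the head of tape [r] records the progress of the
    loop [For x r P], so that [P] may not use [r]. *)
Fixpoint prog_ok (P : prog) : bool :=
  match P with
  | Emit _ => true
  | Cat P Q => prog_ok P && prog_ok Q
  | For x r P => [&& x != r, r \notin regs P, x \notin bound_regs P & prog_ok P]
  end.

Fixpoint compile (out : I) (P : prog) : cmd :=
  match P with
  | Emit u => foldr (fun c d => Sq (put out c) d) (skip out) u
  | Cat P Q => Sq (compile out P) (compile out Q)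
  | For x r P =>
      Sq (While r (fun c => c != blank)
            (Sq (compile out P) (Sq (incr x) (right r))))
         (Sq (rewind r) (clear x))
  end.

(** [V] bounds all registers. Besides [P], an iteration takes at most 4V + 7 steps for [incr], one
    for the move on [r] and one for the test; leaving the loop takes at most 1 + (2V + 3) + (4V + 4)
    steps for the last test, [rewind] and [clear]. *)
Fixpoint cost (P : prog) (V : nat) : nat :=
  match P with
  | Emit u => (size u).+1
  | Cat P Q => cost P V + cost Q V
  | For _ _ P => V * (cost P V + 4 * V + 9) + 6 * V + 8
  end.

(** All tapes other than [out] end as they began: heads of registers at 0, loop counters empty
    again. This is what makes a program fit to be the body of a loop. *)
Lemma runs_compile P out V (e : I -> nat) s o :
  prog_ok P -> out \notin regs P ->
  {in regs P, forall r, s r = (str (marks (e r)), Posz 0)} ->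
  {in regs P, forall r, e r <= V} ->
  {in bound_regs P, forall x, e x = 0} ->
  s out = (str o, Posz (size o)) ->
  exists2 n, n <= cost P V &
    runs (compile out P) s n
      (upd s out (str (o ++ den P e), Posz (size (o ++ den P e)))).
Proof.
elim: P e s o => [u|P IHP Q IHQ|x r P IH] e s o.
- move=> _ _ _ _ _ E; exists (size u).+1 => //=.
  elim: u o s E => [|c u IH] o s E /=.
    by apply: runs_prim E _; rewrite act_keep /= cats0.
  apply: runs_cast (RunSq (runs_put c E) (IH _ _ (updE (I := I) (S := S) _ _
    _))) _ _ => //.
  by rewrite upd_upd cat_rcons.
- move=> /= /andP[okP okQ]; rewrite mem_cat negb_or => /andP[oP oQ] Es Ev Eb Eo.
  case: (IHP e s o) => // [r rP|r rP|x xP|n le_n Hn].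
  + by apply: Es; rewrite mem_cat rP.
  + by apply: Ev; rewrite mem_cat rP.
  + by apply: Eb; rewrite mem_cat xP.
  case: (IHQ e (upd s out (str (o ++ den P e), Posz (size (o ++ den P e))))
    (o ++ den P e) okQ oQ); rewrite ?updE //.
  + move=> r rQ; rewrite updN; first by apply: Es; rewrite mem_cat rQ orbT.
    by apply: contraNneq oQ => <-.
  + by move=> r rQ; apply: Ev; rewrite mem_cat rQ orbT.
  + by move=> r rQ; apply: Eb; rewrite mem_cat rQ orbT.
  move=> n' le_n' Hn'; exists (n + n'); first exact: leq_add.
  by apply: runs_cast (RunSq Hn Hn') erefl _; rewrite upd_upd catA.
move=> /= /and4P[xr rP xP okP]; rewrite !inE !negb_or => /and3P[ox or_ oP].
move=> Es Ev Eb Eo; pose v := e r.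
have Vv : v <= V by apply: Ev; rewrite !inE eqxx orbT.
(* Loop invariant after i iterations: [x] contains i, the head of [r] is at i, and the text for the
   values below i has been written. *)
pose outs i := o ++ flatten [seq den P (put_reg e x j) | j <- iota 0 i].
pose st i := upd (upd (upd s x (str (marks i), Posz 0))
  r (str (marks v), Posz i)) out (str (outs i), Posz (size (outs i))).
have str_r i : st i r = (str (marks v), Posz i).
  by rewrite /st updN 1?eq_sym // updE.
have str_x i : st i x = (str (marks i), Posz 0).
  by rewrite /st updN 1?eq_sym // updN // updE.
have str_o i : st i out = (str (outs i), Posz (size (outs i))).
  by rewrite /st updE.
have st0 : st 0 = s.
  rewrite /st /outs /= cats0 (upd_id (i := x)); last first.
    by rewrite Es ?inE ?eqxx // (Eb x) // inE eqxx.
  by rewrite (upd_id (i := r)) ?upd_id // Es // !inE eqxx orbT.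
have body i : i < v -> exists2 n, n <= cost P V + 4 * V + 8 & runs
    (Sq (compile out P) (Sq (incr x) (right r))) (st i) n (st i.+1).
  move=> lt_i; case: (IH (put_reg e x i) (st i) (outs i)) => //.
  + move=> y yP; rewrite /put_reg; case: (eqVneq y x) => [->|yx] //.
    rewrite /st !updN //; first by apply: Es; rewrite !inE yP !orbT.
      by apply: contraNneq rP => <-.
    by apply: contraNneq oP => <-.
  + move=> y yP; rewrite /put_reg; case: eqP => _.
      exact: leq_trans (ltnW lt_i) Vv.
    by apply: Ev; rewrite !inE yP !orbT.
  + move=> y yP; rewrite /put_reg; case: (eqVneq y x) => [Ey|yx].
      by rewrite -Ey yP in xP.
    by apply: Eb; rewrite inE yP orbT.
  move=> n le_n Hn; exists (n + ((4 * i + 7) + 1)); first by lia.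
  apply: runs_cast (RunSq Hn (RunSq (runs_incr (v := i) _)
    (runs_right (u := marks v) (h := i) _))) erefl _.
  + by rewrite updN 1?eq_sym.
  + by rewrite updN 1?eq_sym // updN 1?eq_sym.
  rewrite (_ : outs i ++ _ = outs i.+1); last first.
    by rewrite /outs -addn1 iotaD map_cat flatten_cat /= cats0 catA.
  apply: functional_extensionality => j; rewrite /st /upd.
  case: (eqVneq j r) => [->|_]; first by rewrite [r == out]eq_sym (negbTE or_).
  by case: (eqVneq j x) => [->|_]; rewrite 1?[x == out]eq_sym ?(negbTE ox) //;
    case: eqP.
have loop k i : i + k = v -> exists2 n,
    n <= k * (cost P V + 4 * V + 9) + 1 & runs
    (While r (fun c => c != blank) (Sq (compile out P) (Sq (incr x) (right r))))
    (st i) n (st v).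
  elim: k i => [|k IHk] i Ei.
    rewrite addn0 in Ei; exists 1 => //; rewrite Ei; apply: RunDone.
    by rewrite str_r /read /= solid_nth ?solid_marks // size_nseq ltnn.
  have [n le_n Hn] := body i ltac:(lia).
  have [n' le_n' Hn'] := IHk i.+1 ltac:(lia).
  exists (n + n').+1; first by lia.
  apply: RunLoop Hn Hn'.
  rewrite str_r /read /= solid_nth ?solid_marks // size_nseq; lia.
have [n le_n Hn] := loop v 0 (add0n _).
exists (n + (v.*2.+3 + (4 * v + 4))).
  suff : v * (cost P V + 4 * V + 9) <= V * (cost P V + 4 * V + 9) by lia.
  by rewrite leq_mul2r Vv orbT.
rewrite st0 in Hn; apply: runs_cast (RunSq Hn (RunSq (runs_rewind
  (solid_marks v) _ (str_r v)) (runs_clear (solid_marks v) _))) _ _.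
- by rewrite size_nseq.
- by rewrite updN // str_x.
- by rewrite size_nseq.
rewrite -/(outs (e r)) -/v -[in RHS]st0.
apply: functional_extensionality => j; rewrite /st /upd.
case: (eqVneq j x) => [->|jx].
  by rewrite [x == out]eq_sym (negbTE ox) (negbTE xr).
by case: (eqVneq j r) => [->|_]; rewrite 1?[r == out]eq_sym ?(negbTE or_) //;
  case: eqP.
Qed.

End Loops.

(** * Polynomial-time transducers *)

(** The base is at least 2 for every n, so that these bounds grow with the exponent and are closed
    under sums and products without exceptions at n = 0 and 1. *)
Definition poly_bounded (f : nat -> nat) := exists c, forall n, f n <= (n + 2) ^
  c.

Lemma poly_boundedW f g : (forall n, f n <= g n) -> poly_bounded g ->
  poly_bounded f.
Proof. by move=> fg [c gc]; exists c => n; apply: leq_trans (gc n). Qed.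

Lemma poly_bounded_const a : poly_bounded (fun=> a).
Proof.
exists a => n; apply: leq_trans (ltnW (ltn_expl a (ltnSn 1))) _.
by case: a => // a; rewrite leq_exp2r // addn2.
Qed.

Lemma poly_bounded_id : poly_bounded id.
Proof. by exists 1 => n; rewrite expn1 leq_addr. Qed.

Lemma poly_boundedM f g : poly_bounded f -> poly_bounded g ->
  poly_bounded (fun n => f n * g n).
Proof. by move=> [c fc] [d gd]; exists (c + d) => n; rewrite expnD leq_mul. Qed.

Lemma poly_boundedD f g : poly_bounded f -> poly_bounded g ->
  poly_bounded (fun n => f n + g n).
Proof.
move=> [c fc] [d gd]; exists (c + d).+1 => n; rewrite expnS.
have [b1 b2] : f n <= (n + 2) ^ (c + d) /\ g n <= (n + 2) ^ (c + d).
  split; [apply: leq_trans (fc n) _ | apply: leq_trans (gd n) _];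
  by rewrite leq_pexp2l ?leq_addr ?leq_addl // addn2.
apply: leq_trans (leq_add b1 b2) _; rewrite addnn -mul2n leq_mul2r; lia.
Qed.

Lemma poly_bounded_expn k : poly_bounded (fun n => n ^ k).
Proof.
by elim: k => [|k IH]; [apply: poly_bounded_const |
  apply: poly_boundedW (poly_boundedM poly_bounded_id IH) => n; rewrite expnS].
Qed.

Lemma poly_bounded_sum (T : Type) (s : seq T) (f : T -> nat -> nat) :
  (forall i, poly_bounded (f i)) -> poly_bounded (fun n => \sum_(i <- s) f i n).
Proof.
move=> pf; elim: s => [|i s IH].
  by apply: poly_boundedW (poly_bounded_const 0) => n; rewrite big_nil.
by apply: poly_boundedW (poly_boundedD (pf i) IH) => n; rewrite big_cons.
Qed.

(** For n >= 2, n + 2 <= n ^ 2 turns the bound into n ^ (2c); at n = 0 and 1 it is at most 3 ^ c,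
    which the additive constant covers. *)
Lemma poly_bounded_poly_bound f : poly_bounded f ->
  exists k, forall n, f n <= poly_bound k n.
Proof.
move=> [c fc]; exists (2 * c + 3 ^ c) => n; rewrite /poly_bound.
apply: leq_trans (fc n) _; have [le_n|lt_n] := leqP n 1.
  apply: leq_trans (_ : 3 ^ c <= _); last by lia.
  by case: c {fc} => // c; rewrite leq_exp2r //; lia.
apply: leq_trans (_ : (n ^ 2) ^ c <= _).
  case: c {fc} => // c; rewrite leq_exp2r //; nia.
by rewrite -expnM (leq_trans _ (leq_addr _ _)) // leq_pexp2l ?leq_addr //; lia.
Qed.

Lemma poly_bounded_cost I S (P : prog I S) V : poly_bounded V ->
  poly_bounded (fun n => cost P (V n)).
Proof.
move=> pV; elim: P => [u|P IHP Q IHQ|x r P IH] /=.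
- exact: poly_bounded_const.
- exact: poly_boundedD.
- by repeat first [exact: poly_bounded_const | exact: pV | exact: IH
    | apply: poly_boundedD | apply: poly_boundedM].
Qed.

Section RunAll.
Variables I S : finType.

Definition all_cmd (i0 : I) (c : I -> cmd I S) (l : seq I) : cmd I S :=
  foldr (fun i d => Sq (c i) d) (skip S i0) l.

Lemma runs_skip (i : I) (s : tapes I S) : runs (skip S i) s 1 s.
Proof.
by rewrite -{2}(upd_id (erefl (s i))); apply: runs_prim (erefl _) (act_id _).
Qed.

Lemma runs_all_cmd i0 c l (t t' : tapes I S) N : uniq l ->
  (forall i s, s i = t i -> exists2 n, n <= N & runs (c i) s n (upd s i (t' i)))
    ->
  forall s, {in l, s =1 t} -> exists2 n, n <= size l * N + 1 &
  runs (all_cmd i0 c l) s n (fun j => if j \in l then t' j else s j).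
Proof.
move=> ul cP; elim: l ul => [|i l IH] /= => [_|/andP[il ul]] s st.
  by exists 1 => //; apply: runs_skip.
have [|n le_n Hn] := cP i s; first by apply: st; rewrite inE eqxx.
have [j jl|n' le_n' Hn'] := IH ul (upd s i (t' i)).
  by rewrite updN ?st ?inE ?jl ?orbT //; apply: contraNneq il => <-.
exists (n + n'); first by rewrite /= mulSn -addnA leq_add.
apply: runs_cast (RunSq Hn Hn') erefl _.
apply: functional_extensionality => j; rewrite inE /upd.
by case: (eqVneq j i) => [->|] //=; rewrite (negbTE il).
Qed.
End RunAll.

(** * Transducers emitting one piece of text per input letter *)

Section Transducer.
Variables (A B : finType) (k extra : nat).

Definition tape_symbol : finType := option (A + B + unit).
Notation S := tape_symbol.
Notation blank := (None : S).
Notation mark := (Some (inr tt) : S).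
Definition in_symbol (a : A) : S := Some (inl (inl a)).
Definition out_symbol (b : B) : S := Some (inl (inr b)).

(** Computing n ^ k takes k nested loops over n, and an inner loop may not run over the register of
    an outer one. So the input length is stored k + 1 times, one copy serving the summand n, each
    with a counter of its own. *)
Definition last_tape := 8 + k.*2.
Notation I := 'I_last_tape.+1.
Notation str := (string_on blank).
Notation ticks := (marks mark).

Definition reg (i : nat) : I := inord i.
Definition outR : I := ord_max.

Lemma reg_val i : i <= last_tape -> val (reg i) = i.
Proof. by move=> le_i; rewrite /reg /= inordK. Qed.

(** Tapes 1 to 3 contain the parameter [m] (minus 1 in tape 1), tapes 4 and 5
    are counters; tapes 6 + 2i contain the length of the input, and tapes
    7 + 2i are counters for loops over these. *)
Definition param (n : nat) := n ^ k + n + extra.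
Definition is_length_tape (t : nat) := [&& 6 <= t, t < last_tape & ~~ odd t].
(** The value m is needed twice because the loop over the bits of a block (tape 2) contains the loop
    that prints variable indices (tape 3); the carry conditions are indexed by m - 1 values (tape
    1). *)
Definition env (n : nat) (j : I) : nat :=
  if is_length_tape j then n else
  if val j == 1 then param n else if val j \in [:: 2;
    3] then (param n).+1 else 0.

Definition length_tapes : seq I := [seq j : I <- enum I | is_length_tape j].

Fixpoint nest (i : nat) : prog I S :=
  if i is i'.+1 then For (reg (7 + i.*2)) (reg (6 + i.*2)) (nest i')
  else Emit I [:: mark].

Definition param_prog (e : nat) : prog I S :=
  Cat (Emit I (ticks e)) (Cat (nest k) (For (reg 7) (reg 6) (Emit I [::
    mark]))).

Lemma regs_nest i : i <= k ->
  {in regs (nest i), forall r : I, 8 <= r < 8 + i.*2}.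
Proof.
elim: i => //= i IH lt_i r; rewrite !inE => /or3P[/eqP->|/eqP->|/IH].
- by rewrite reg_val /last_tape; lia.
- by rewrite reg_val /last_tape; lia.
- by lia.
Qed.

Lemma bound_nest i : i <= k -> {in bound_regs (nest i), forall r : I, odd r}.
Proof.
elim: i => //= i IH lt_i r; rewrite inE => /orP[/eqP->|/IH]; last by apply; lia.
by rewrite reg_val /last_tape; lia.
Qed.

Lemma sub_bound (T U : finType) (P : prog T U) :
  {subset bound_regs P <= regs P}.
Proof.
elim: P => [//|P IHP Q IHQ|x r P IH] y /=.
  by rewrite !mem_cat => /orP[/IHP->|/IHQ->]; rewrite ?orbT.
by rewrite !inE => /orP[->//|/IH->]; rewrite !orbT.
Qed.

Lemma nest_ok i : i <= k -> prog_ok (nest i).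
Proof.
elim: i => //= i IH lt_i; rewrite -val_eqE !reg_val /last_tape; try lia.
rewrite IH ?andbT; last by lia.
apply/and3P; split; first by lia.
- apply/negP => /regs_nest; rewrite reg_val /last_tape; lia.
- apply/negP => /sub_bound /regs_nest; rewrite reg_val /last_tape; lia.
Qed.

Lemma flatten_ticks (u : seq nat) v :
  flatten [seq ticks v | _ <- u] = ticks (size u * v).
Proof. by elim: u => //= _ u ->; rewrite /marks mulSn nseqD. Qed.

Lemma den_nest i e n : i <= k ->
  (forall j, 0 < j <= i -> e (reg (6 + j.*2)) = n) ->
  den (nest i) e = ticks (n ^ i).
Proof.
elim: i e => //= i IH e lt_i En; rewrite En; last by lia.
rewrite (eq_map (g := fun=> ticks (n ^ i))) => [|v].
  by rewrite flatten_ticks size_iota expnS.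
apply: IH => [|j lt_j]; first by lia.
rewrite /put_reg -val_eqE !reg_val /last_tape; try lia.
by case: eqP => [|_]; [lia | apply: En; lia].
Qed.

Lemma env_length_tape n (j : I) : is_length_tape j -> env n j = n.
Proof. by rewrite /env => ->. Qed.

Lemma den_param_prog e n : den (param_prog e) (env n) = ticks (n ^ k + n + e).
Proof.
rewrite /= (den_nest (n := n)) // => [|j lt_j]; last first.
  by rewrite env_length_tape // reg_val /is_length_tape /last_tape; lia.
rewrite env_length_tape ?reg_val // /is_length_tape /last_tape; try lia.
rewrite (flatten_ticks _ 1) size_iota muln1.
by rewrite /marks -!nseqD; congr nseq; lia.
Qed.

Lemma regs_param_prog e : {in regs (param_prog e), forall r :
  I, 6 <= r < last_tape}.
Proof.
move=> r; rewrite /= mem_cat !inE ?orbF.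
by case/orP=> [/regs_nest|/orP[]/eqP->]; rewrite ?reg_val /last_tape; lia.
Qed.

Lemma param_prog_ok e : prog_ok (param_prog e).
Proof. by rewrite /= nest_ok //= -val_eqE !reg_val /last_tape; lia. Qed.

Lemma bound_param_prog e : {in bound_regs (param_prog e), forall r : I, odd r}.
Proof.
move=> r; rewrite /= mem_cat inE => /orP[/bound_nest->//|/eqP->].
by rewrite reg_val /last_tape; lia.
Qed.

Definition read_state (w : seq A) (h : nat) : tapes I S := fun j =>
  if val j == 0 then (str (map in_symbol w), Posz h)
  else if is_length_tape j then (str (ticks h), Posz h) else (str [::], Posz 0).

Definition read_cmd : cmd I S := While ord0 (fun c => c != blank)
  (Sq (right S ord0) (all_cmd ord0 (fun i => put i mark) length_tapes)).

Definition rewind_cmd : cmd I S :=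
  all_cmd ord0 (rewind blank) (ord0 :: length_tapes).

(** The compiler also initialises the parameters, with a parameter tape in the role of the output.
    It leaves the head at the end of the string, whence the rewinding. *)
Definition fill (i : I) (P : prog I S) : cmd I S :=
  Sq (compile blank mark i P) (rewind blank i).


Definition rewound_state (w : seq A) : tapes I S := fun j =>
  if val j == 0 then (str (map in_symbol w), Posz 0)
  else if is_length_tape j then (str (ticks (size w)), Posz 0) else (str [::],
    Posz 0).

Definition work_state (w : seq A) (h : nat) (o : seq S) : tapes I S := fun j =>
  if val j == 0 then (str (map in_symbol w), Posz h)
  else if val j == last_tape then (str o, Posz (size o))
  else (str (ticks (env (size w) j)), Posz 0).

Lemma solid_input w : solid blank (map in_symbol w).
Proof. by elim: w. Qed.

Lemma solid_ticks v : solid blank (ticks v).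
Proof. exact: solid_marks. Qed.

Lemma length_tape_neq0 (j : I) : is_length_tape j -> val j != 0.
Proof. by rewrite /is_length_tape => /and3P[] /=; lia. Qed.

Lemma mem_length_tapes (j : I) : (j \in length_tapes) = is_length_tape j.
Proof. by rewrite mem_filter mem_enum andbT. Qed.

Lemma uniq_length_tapes : uniq length_tapes.
Proof. by rewrite filter_uniq ?enum_uniq. Qed.

Lemma size_length_tapes : size length_tapes <= last_tape.+1.
Proof. by rewrite size_filter (leq_trans (count_size _ _)) // size_enum_ord.
  Qed.

Lemma runs_read w : exists2 n, n <= size w * (last_tape + 4) + 1 &
  runs read_cmd (read_state w 0) n (read_state w (size w)).
Proof.
suff loop d h : h + d = size w -> exists2 n, n <= d * (last_tape + 4) + 1 &
    runs read_cmd (read_state w h) n (read_state w (size w)) by apply: loop.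
elim: d h => [|d IH] h Eh.
  exists 1 => //; rewrite addn0 in Eh; rewrite -Eh; apply: RunDone.
  by rewrite /read_state /= /read /= nth_default // size_map Eh.
have [n' le_n' Hn'] := IH h.+1 ltac:(lia).
have R := @runs_right I S blank ord0 (read_state w h) (map in_symbol w) h erefl.
have [||n le_n Hn] := @runs_all_cmd I S ord0 (fun i => put i mark) length_tapes
  (fun=> (str (ticks h), Posz h)) (fun=> (str (ticks h.+1), Posz h.+1)) 1
  uniq_length_tapes _ (upd (read_state w h) ord0 (str (map in_symbol w), Posz
    h.+1)).
- move=> i s Es; exists 1 => //.
  have := @runs_put I S blank i s (ticks h) mark.
  by rewrite marksS !size_nseq; apply.
- move=> j; rewrite mem_length_tapes => jl; have j0 := length_tape_neq0 jl.
  by rewrite updN // /read_state (negbTE j0) jl.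
exists ((1 + n) + n').+1; first by move: le_n le_n' size_length_tapes;
  rewrite muln1 mulSn; move: (size length_tapes) (d * _) => x y; lia.
apply: RunLoop (runs_cast (RunSq R Hn) erefl _) Hn'.
  by rewrite /read_state /= /read /= solid_nth ?solid_input // size_map; lia.
apply: functional_extensionality => j; rewrite mem_length_tapes /upd
  /read_state.
rewrite -val_eqE /=; case: (eqVneq (j : nat) 0) => j0;
  last by case: (is_length_tape j).
by case: ifP => // /length_tape_neq0 /=; rewrite j0.
Qed.

Lemma runs_rewind_all w : exists2 n, n <= (last_tape + 2) * ((size w).*2 + 3) +
  1 &
  runs rewind_cmd (read_state w (size w)) n (rewound_state w).
Proof.
pose t' (j : I) := if val j == 0 then (str (map in_symbol w), Posz 0)
  else (str (ticks (size w)), Posz 0).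
have uniq_l : uniq (ord0 :: length_tapes : seq I).
  by rewrite /= uniq_length_tapes andbT mem_length_tapes.
have [||n le_n Hn] := @runs_all_cmd I S ord0 (rewind blank) _
  (fun j => if val j == 0 then (str (map in_symbol w), Posz (size w))
    else (str (ticks (size w)), Posz (size w))) t' ((size w).*2 + 3)
  uniq_l _ (read_state w (size w)).
- move=> i s Es; exists (size w).*2.+3; first by lia.
  rewrite /t'; move: Es; case: eqP => _ Es; apply: runs_rewind Es.
  + exact: solid_input.
  + by rewrite size_map.
  + exact: solid_ticks.
  + by rewrite size_nseq.
- move=> j; rewrite inE mem_length_tapes -val_eqE /read_state /=.
  by case: eqP => //= _ ->.
exists n.
  apply: leq_trans le_n _; rewrite /= leq_add2r leq_mul2r; apply/orP; right.
  by have := size_length_tapes; lia.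
apply: runs_cast Hn erefl _; apply: functional_extensionality => j.
rewrite inE mem_length_tapes -val_eqE /read_state /rewound_state /t' /=.
by case: eqP => //= _; case: (is_length_tape j).
Qed.

Lemma runs_fill i e n s : i \in [:: 1; 2; 3] ->
  (forall r : I, 6 <= r < last_tape -> s r = (str (ticks (env n r)), Posz 0)) ->
  s (reg i) = (str [::], Posz 0) ->
  exists2 N, N <= cost (param_prog e) n + ((n ^ k + n + e).*2 + 3) &
  runs (fill (reg i) (param_prog e)) s N
    (upd s (reg i) (str (ticks (n ^ k + n + e)), Posz 0)).
Proof.
move=> i123 Es Ei.
have vi : val (reg i) = i by rewrite reg_val // /last_tape; move: i123;
  rewrite !inE; lia.
have [||||||N le_N HN] := @runs_compile I S blank mark isT (param_prog e) (reg
  i)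
  n (env n) s [::].
- exact: param_prog_ok.
- by apply/negP => /regs_param_prog; rewrite vi; move: i123; rewrite !inE; lia.
- by move=> r /regs_param_prog; apply: Es.
- move=> r /regs_param_prog lt_r; rewrite /env !inE /=; case: ifP => // _.
  by rewrite !ifF //; lia.
- move=> r rb; have := bound_param_prog rb.
  have := regs_param_prog (sub_bound rb).
  by rewrite /env /is_length_tape !inE /= => lt_r odd_r; rewrite !ifF //; lia.
- by [].
rewrite cat0s den_param_prog in HN.
exists (N + (n ^ k + n + e).*2.+3); first by lia.
have R := @runs_rewind I S blank (reg i) _ _ _ (solid_ticks (n ^ k + n + e))
  (leqnn _) (updE s (reg i) _).
apply: runs_cast (RunSq HN R) _ _; first by rewrite size_nseq.
by rewrite upd_upd.
Qed.

Definition fill_cmd : cmd I S :=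
  Sq (fill (reg 1) (param_prog extra)) (Sq (fill (reg 2) (param_prog extra.+1))
    (fill (reg 3) (param_prog extra.+1))).

Definition fill_cost n := cost (param_prog extra) n +
  cost (param_prog extra.+1) n + cost (param_prog extra.+1) n +
  6 * (param n + 4).

Lemma runs_fill_cmd w : exists2 n, n <= fill_cost (size w) &
  runs fill_cmd (rewound_state w) n (work_state w 0 [::]).
Proof.
set n := size w.
have E2 (r : I) : 6 <= r < last_tape -> rewound_state w r = (str (ticks (env n
  r)), Posz 0).
  rewrite /rewound_state /env !inE /= => lt_r; rewrite ifF; last by lia.
  by case: ifP => // _; rewrite !ifF //; lia.
have E0 (i : nat) : i \in [:: 1; 2; 3] -> rewound_state w (reg i) = (str [::],
  Posz 0).
  rewrite !inE => i123; have vi : (reg i : nat) = i.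
    by apply: reg_val; rewrite /last_tape; lia.
  by rewrite /rewound_state /= vi !ifF // /is_length_tape; lia.
have ne (i j : nat) : i \in [:: 1; 2; 3] -> j \in [:: 1; 2; 3] -> i != j ->
    reg i != reg j.
  by rewrite !inE -val_eqE => ? ?; rewrite !reg_val /last_tape; lia.
have ne6 (i : nat) (r : I) : i \in [:: 1; 2;
  3] -> 6 <= r < last_tape -> r != reg i.
  rewrite !inE => i123 lt_r; apply/eqP => Er; move: lt_r.
  by rewrite Er (_ : (reg i : nat) = i); [lia | apply: reg_val;
    rewrite /last_tape; lia].
pose s1 := upd (rewound_state w) (reg 1) (str (ticks (n ^ k + n + extra)), Posz
  0).
pose s2 := upd s1 (reg 2) (str (ticks (n ^ k + n + extra.+1)), Posz 0).
have [|||N1 le1 H1] := @runs_fill 1 extra n (rewound_state w) => //;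
  first exact: E0.
have [||| N2 le2 H2] := @runs_fill 2 extra.+1 n s1 => //.
- by move=> r lt_r; rewrite /s1 updN ?E2 // ne6.
- by rewrite /s1 updN ?E0 // ne.
have [|||N3 le3 H3] := @runs_fill 3 extra.+1 n s2 => //.
- by move=> r lt_r; rewrite /s2 /s1 !updN ?E2 // ne6.
- by rewrite /s2 /s1 !updN ?E0 // ne.
exists (N1 + (N2 + N3)).
  by rewrite /fill_cost /param; lia.
apply: runs_cast (RunSq H1 (RunSq H2 H3)) erefl _.
apply: functional_extensionality => j.
rewrite /s2 /s1 /upd /work_state /rewound_state /env -!val_eqE !reg_val
  ?/last_tape //= -/n /param !inE.
case: (eqVneq (j : nat) 0) => [->|j0]; first by [].
case: (eqVneq (j : nat) 3) => [->|j3]; first by rewrite addnS.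
case: (eqVneq (j : nat) 2) => [->|j2]; first by rewrite addnS.
case: (eqVneq (j : nat) 1) => [->|j1]; first by [].
case: (eqVneq (j : nat) _) => [->|jn]; last by case: ifP.
by rewrite /is_length_tape ltnn andbF.
Qed.

(** Only tapes 4 and 5 may be bound: they are empty in [env], as [runs_compile] demands of loop
    counters. *)
Definition work_regs (P : prog I S) :=
  [&& prog_ok P, all (fun r : I => 1 <= r <= 5) (regs P) &
      all (fun r : I => 4 <= r <= 5) (bound_regs P)].

Definition maxval n := (param n).+1 + n.

Lemma env_maxval n r : env n r <= maxval n.
Proof.
by rewrite /env /maxval; case: ifP => _; [|case: ifP => _; [|case: ifP]]; lia.
Qed.

Lemma runs_emit P w h o : work_regs P ->
  exists2 n, n <= cost P (maxval (size w)) &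
  runs (compile blank mark outR P) (work_state w h o) n
    (work_state w h (o ++ den P (env (size w)))).
Proof.
case/and3P=> okP /allP rP /allP bP.
have [||||||n le_n Hn] := @runs_compile I S blank mark isT P outR
  (maxval (size w)) (env (size w)) (work_state w h o) o => //.
- by apply/negP => /rP; rewrite /= /last_tape; lia.
- move=> r /rP /= lt_r; have [r0 rn] : (r == 0 :> nat) = false /\ (r ==
  last_tape :> nat) = false.
    by rewrite /last_tape; move: (nat_of_ord r) lt_r => x; lia.
  by rewrite /work_state /= r0 rn.
- by move=> r _; apply: env_maxval.
- by move=> r /bP /= lt_r; rewrite /env /is_length_tape !inE /= !ifF //; lia.
- by rewrite /work_state /= eqxx.
exists n => //; apply: runs_cast Hn erefl _.
apply: functional_extensionality => j; rewrite /upd /work_state -val_eqE /=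
  -/last_tape.
by case: (eqVneq (j : nat) last_tape) => [->|].
Qed.

Variables (pre suf : prog I S) (seg : A -> prog I S).
Hypotheses (pre_ok : work_regs pre) (suf_ok : work_regs suf)
  (seg_ok : forall a, work_regs (seg a)).

Definition case_cmd (l : seq A) : cmd I S :=
  foldr (fun a c => Sq (If ord0 (fun c => c == in_symbol a)
    (compile blank mark outR (seg a)) (skip S ord0)) c) (skip S ord0) l.

(** The letter under the head does not change during the tests, so that without repetitions in [l]
    at most one segment is emitted. *)
Lemma runs_case l w h o a : uniq l -> h < size w -> nth a w h = a ->
  exists2 n, n <= (\sum_(b <- l) (cost (seg b) (maxval (size w)) + 2)) + 1 &
  runs (case_cmd l) (work_state w h o) n
    (work_state w h (if a \in l then o ++ den (seg a) (env (size w)) else o)).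
Proof.
move=> ul lt_h Ea; elim: l ul o => [|b l IH] /= => [_|/andP[bl ul]] o.
  by exists 1; [rewrite big_nil | apply: runs_skip].
have Er : read (work_state w h o ord0) = in_symbol a.
  by rewrite /work_state /read /= (nth_map a) // Ea.
have [n le_n Hn] : exists2 n, n <= cost (seg b) (maxval (size w)) + 2 &
    runs (If ord0 (fun c => c == in_symbol b) (compile blank mark outR (seg b))
      (skip S ord0)) (work_state w h o) n
      (work_state w h (if a == b then o ++ den (seg b) (env (size w)) else o)).
  have [n le_n Hn] := runs_emit w h o (seg_ok b).
  have -> : (a == b) = (in_symbol a == in_symbol b) by [].
  rewrite -Er; case Ep: (read (work_state w h o ord0) == in_symbol b).
    by exists n.+1; [rewrite addn2 ltnS leqW | apply: RunIf; rewrite Ep].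
  by exists 2; [apply: leq_addl | apply: RunIf; rewrite Ep; apply: runs_skip].
have [n' le_n' Hn'] := IH ul (if a == b then o ++ den (seg b) (env (size w))
  else o).
exists (n + n'); first by rewrite big_cons -addnA leq_add.
apply: runs_cast (RunSq Hn Hn') erefl _; rewrite inE.
by case: (eqVneq a b) => //= ->; rewrite (negbTE bl).
Qed.

Definition scan_cmd : cmd I S := While ord0 (fun c => c != blank)
  (Sq (case_cmd (enum A)) (right S ord0)).

Definition scan_cost n :=
  n * ((\sum_(b <- enum A) (cost (seg b) (maxval n) + 2)) + 3) + 1.

Lemma runs_scan w o : exists2 n, n <= scan_cost (size w) &
  runs scan_cmd (work_state w 0 o) n
    (work_state w (size w) (o ++ flatten [seq den (seg a) (env (size w)) | a <-
      w])).
Proof.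
rewrite /scan_cost; set C := (\sum_(b <- _) _).
suff loop v u p : w = u ++ v -> exists2 n, n <= size v * (C + 3) + 1 &
    runs scan_cmd (work_state w (size u) p) n
    (work_state w (size w) (p ++ flatten [seq den (seg a) (env (size w)) | a <-
      v])).
  exact: (loop w [::]).
elim: v u p => [|a v IH] u p Ew.
  exists 1 => //; rewrite /= cats0 Ew cats0; apply: RunDone.
  by rewrite /work_state /= /read /= nth_default // size_map.
have lt_u : size u < size w by rewrite Ew size_cat /= -addSnnS leq_addr.
have Ea : nth a w (size u) = a by rewrite Ew nth_cat ltnn subnn.
have [n le_n] := runs_case p (enum_uniq A) lt_u Ea.
rewrite mem_enum inE => Hn.
have [|n' le_n'] := IH (rcons u a) (p ++ den (seg a) (env (size w))).
  by rewrite cat_rcons.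
rewrite size_rcons => Hn'.
exists ((n + 1) + n').+1; first by rewrite /= mulSn -/C in le_n *; lia.
have R := @runs_right I S blank ord0
  (work_state w (size u) (p ++ den (seg a) (env (size w)))) (map in_symbol w) _
    erefl.
rewrite /= catA; apply: RunLoop (runs_cast (RunSq Hn R) erefl _) Hn'.
  by rewrite /work_state /read /= (nth_map a) // Ea.
apply: functional_extensionality => j; rewrite /upd /work_state -val_eqE /=.
by case: eqP.
Qed.

Definition main_cmd : cmd I S :=
  Sq read_cmd (Sq rewind_cmd (Sq fill_cmd
    (Sq (compile blank mark outR pre)
      (Sq scan_cmd (compile blank mark outR suf))))).

Definition main_cost n :=
  n * (last_tape + 4) + 1 + ((last_tape + 2) * (n.*2 + 3) + 1) + fill_cost n +
  cost pre (maxval n) + scan_cost n + cost suf (maxval n).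

Lemma runs_main w : exists2 n, n <= main_cost (size w) &
  runs main_cmd (input_tapes blank in_symbol w) n (work_state w (size w)
    (den pre (env (size w)) ++ flatten [seq den (seg a) (env (size w)) | a <- w]
     ++ den suf (env (size w)))).
Proof.
have -> : @input_tapes _ _ blank in_symbol last_tape w = read_state w 0.
  apply: functional_extensionality => j; rewrite /input_tapes /read_state
    -val_eqE /=.
  case: eqP => // _; rewrite if_same; congr pair.
  by apply: functional_extensionality => -[z|z] //=; rewrite nth_nil.
have [n1 le1 H1] := runs_read w; have [n2 le2 H2] := runs_rewind_all w.
have [n3 le3 H3] := runs_fill_cmd w.
have [n4 le4 H4] := runs_emit w 0 [::] pre_ok.
have [n5 le5 H5] := runs_scan w ([::] ++ den pre (env (size w))).
have [n6 le6 H6] := runs_emit w (size w) (([::] ++ den pre (env (size w))) ++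
  flatten [seq den (seg a) (env (size w)) | a <- w]) suf_ok.
exists (n1 + (n2 + (n3 + (n4 + (n5 + n6))))); first by rewrite /main_cost; lia.
apply: runs_cast (RunSq H1 (RunSq H2 (RunSq H3 (RunSq H4 (RunSq H5 H6))))) _ _
  => //.
by rewrite cat0s catA.
Qed.

Lemma poly_bounded_main : poly_bounded main_cost.
Proof.
have pp : poly_bounded param.
  apply: poly_boundedD; last exact: poly_bounded_const.
  exact: poly_boundedD (poly_bounded_expn k) poly_bounded_id.
have pm : poly_bounded maxval.
  apply: poly_boundedD poly_bounded_id.
  apply: poly_boundedW (poly_boundedD pp (poly_bounded_const 1)) => n; lia.
have pd : poly_bounded double.
  by apply: poly_boundedW (poly_boundedD poly_bounded_id poly_bounded_id) => n;
    lia.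
have pc := @poly_bounded_cost I S.
rewrite /main_cost /fill_cost /scan_cost.
by repeat first [exact: poly_bounded_const | exact: poly_bounded_id
  | exact: pp | exact: pm | exact: pd | (apply: pc; exact: poly_bounded_id)
  | exact: pc | apply: poly_bounded_sum => ?
  | apply: poly_boundedD | apply: poly_boundedM].
Qed.

(** The segment of a letter depends on this letter and on the input length, but not on the position
    in the input. The formula describing the input is designed to respect this restriction. *)
Theorem transducer_ptime (f : seq A -> seq B) :
  (forall w, map out_symbol (f w) = den pre (env (size w)) ++
     flatten [seq den (seg a) (env (size w)) | a <- w] ++
     den suf (env (size w))) ->
  ptime_computable f.
Proof.
move=> Ef; have [K leK] := poly_bounded_poly_bound poly_bounded_main.
apply: (@cmd_ptime A B S blank in_symbol out_symbol last_tape main_cmd K) => //.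
- by move=> a b [].
- by move=> a b [].
move=> w; have [n le_n Hn] := runs_main w.
eexists n, _; split; [exact: leq_trans (leK _) | exact: Hn|].
by rewrite /work_state /= eqxx Ef.
Qed.

End Transducer.

(** * Tableaux of accepting runs *)

(** Separates the configurations, which are defined for any list of actions, from the enabledness of
    each action, which a tableau checks row by row. *)
Lemma exec_foldl (A : finType) (M : machine A) (C C' : config M) s :
  exec C s = Some C' <->
  foldl (@step _ M) C s = C' /\
  forall t b, onth s t = Some b -> b \in enabled (foldl (@step _ M) C (take t
    s)).
Proof.
elim: s C => [|a s IH] C /=.
  split=> [[<-]|[<- _]//]; split=> // t b; by rewrite onth0n.
split=> [|[E H]].
  case: ifP => // Ca /IH[<- H]; split=> // -[|t] b /=; last exact: H.
  by case=> <-.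
rewrite (H 0 a erefl); apply/IH; split=> // t b Et; exact: (H t.+1 b Et).
Qed.

Lemma chead_foldl (A : finType) (M : machine A) (C : config M) s i (h : nat) :
  (- h%:Z <= chead C i <= h%:Z)%R ->
  (- (h + size s)%:Z <= chead (foldl (@step _ M) C s) i <= (h + size s)%:Z)%R.
Proof.
elim: s C h => [|a s IH] C h H /=; first by rewrite addn0.
rewrite -addSnnS; apply: IH; rewrite /= /shift; case: (a.2 i).2; lia.
Qed.

(** Applied to the actions recorded in the rows of a tableau: once [None] appears it persists, so
    that they form a list. *)
Lemma stable_onth (X : Type) (f : nat -> option X) (B : nat) :
  (forall t, t.+1 < B -> f t = None -> f t.+1 = None) ->
  exists2 u : seq X, size u <= B & forall t, t < B -> f t = onth u t.
Proof.
elim: B => [|B IH] stab; first by exists [::].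
have [t lt_t|u le_u Eu] := IH; first by apply: stab; apply: ltnW.
case E: (f B) => [x|]; last first.
  exists u => [|t]; first exact: leqW.
  rewrite ltnS leq_eqVlt => /orP[/eqP->|/Eu//].
  by rewrite E onth_default.
have szu : size u = B.
  case: B {IH} stab le_u Eu E => [|B] stab le_u Eu E; first by case: u le_u Eu.
  apply/eqP; rewrite eqn_leq le_u /= -onthTE -Eu //.
  by case E': (f B) => //; rewrite stab in E.
exists (rcons u x) => [|t]; first by rewrite size_rcons szu.
rewrite ltnS -cats1 onth_cat szu leq_eqVlt => /orP[/eqP->|lt_t].
  by rewrite ltnn subnn.
by rewrite lt_t Eu.
Qed.

Section Tableaux.
Variables (A : finType) (M : machine A) (w : seq A) (T B : nat).
Notation action := (action M).
Notation step := (@step _ M).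
Notation I := ('I_(ntapes M).+1).

Definition observed : finType := {ffun I -> symbol M}.
(** A cell at time [t] and position [p]: the state at time [t], the symbols
    read, and the next action ([None] when the machine has halted); then the
    symbols in position [p] and which heads are there. *)
Definition cell : finType :=
  (state M * observed * option action *
   ({ffun I -> symbol M} * {ffun I -> bool}))%type.

Notation Z := 'Z_B.
Definition tableau : finType := {ffun Z * Z -> cell}.

(** The symbols that a row claims to read are checked in the cells where the heads stand. A row
    without an action must be halted and accepting, which rules out tableaux of rejecting runs. *)
Definition legal (c : cell) : bool :=
  [forall i, c.2.2 i ==> (c.2.1 i == c.1.1.2 i)] &&
  if c.1.2 is Some b then b \in delta c.1.1.1 c.1.1.2
  else (delta c.1.1.1 c.1.1.2 == set0) && (c.1.1.1 \in accept M).

(** A head moving left arrives from the right neighbour, and conversely. Without an action the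
    configuration is repeated, so that the rows after the end of a run leave no choice. *)
Definition evolves (l c r d : cell) : bool :=
  if c.1.2 is Some b then
    (d.1.1.1 == b.1) &&
    (d.2 == ([ffun i => if c.2.2 i then (b.2 i).1 else c.2.1 i],
             [ffun i => match (b.2 i).2 with
                        | Left => r.2.2 i | Stay => c.2.2 i | Right => l.2.2 i
                        end]))
  else (d.1.1.1 == c.1.1.1) && (d.2 == c.2).

Definition initial (zp : bool) (c : cell) : bool :=
  (c.1.1.1 == start M) &&
  [forall i, (c.2.2 i == zp) && ((i != ord0) ==> (c.2.1 i == blank M))].

(** The cells [l], [c], [r] are at time t and positions p - 1, p, p + 1, and [d]
    is at time t + 1 and position p; [zt], [zt'] and [zp] tell whether t, t + 1
    and p are 0.  There is no condition from the last row to the first one. *)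
Definition window (zt zt' zp : bool) (l c r d : cell) : bool :=
  [&& l.1 == c.1, legal c, zt' || evolves l c r d, zt ==> initial zp c &
      [&& zt, ~~ zp & l.2.1 ord0 == blank M] ==> (c.2.1 ord0 == blank M)].

(** Prescribes only the input and one blank after it; the last clause of [window] spreads this blank
    to the right, around the cycle, as far as position -1. *)
Fixpoint reads (S : eqType) (tp : Z -> S) (z : Z) (bl : S) (v : seq S) : bool :=
  if v is a :: v' then (tp z == a) && reads tp (z + 1)%R bl v' else tp z == bl.

Definition tableau_ok (tab : tableau) : bool :=
  [forall t : Z, forall p : Z,
     window (t == 0)%R (t + 1 == 0)%R (p == 0)%R
       (tab (t, p - 1)%R) (tab (t, p)) (tab (t, p + 1)%R) (tab (t + 1, p)%R)] &&
  reads (fun p => (tab (0, p)%R).2.1 ord0) 0%R (blank M) (map (@letter _ M) w).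

(** The representatives -(T + 2), ..., B - T - 3 of the residues must include the neighbours of all
    head positions in [-T, T], and the input with the blank after it. *)
Hypotheses (B_T : T.*2 + 5 < B) (B_w : size w + T + 2 < B).

Let B1 : 1 < B. Proof. by apply: leq_ltn_trans B_T; lia. Qed.

Lemma Z_lt (p : Z) : p < B.
Proof. by have := ltn_ord p; rewrite [X in _ < X](Zp_cast B1). Qed.

Lemma Z_nat (p : Z) : p = (p : nat)%:R%R.
Proof. by rewrite natr_Zp. Qed.

Lemma Z_val j : j < B -> (j%:R%R : Z) = j :> nat.
Proof. by move=> lt_j; rewrite val_Zp_nat // modn_small. Qed.

Lemma Z_eq0 j : j < B -> (j%:R%R == 0%R :> Z) = (j == 0).
Proof. by move=> lt_j; rewrite -val_eqE /= Z_val. Qed.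

Lemma Z_S0 (t : Z) : (t + 1 == 0)%R = (t.+1 == B).
Proof.
rewrite [t in LHS]Z_nat natr1; have := Z_lt t; rewrite leq_eqVlt.
case: eqP => [-> _|_ /= lt_t]; first by rewrite pchar_Zp ?eqxx.
by rewrite Z_eq0.
Qed.

(** Positions are integers modulo [B]; heads stay within [-T, T], so that
    they can be identified from their residues. *)
Definition coord (p : Z) : int := (Posz (p + (T + 2)%:R : Z)%R - Posz (T +
  2))%R.

Lemma coord_ge p : (- (T + 2)%:Z <= coord p)%R.
Proof. by rewrite /coord; lia. Qed.

Lemma coord_lt p : (coord p < B%:Z - (T + 2)%:Z)%R.
Proof. by have := Z_lt (p + (T + 2)%:R)%R; rewrite /coord; lia. Qed.

Lemma coordK p : (coord p)%:~R%R = p.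
Proof.
rewrite /coord; set q := (p + _)%R.
have Eq : (Posz q)%:~R%R = q by exact: natr_Zp.
by rewrite rmorphB /= Eq /q -pmulrn addrK.
Qed.

Lemma coordE (z : int) :
  (- (T + 2)%:Z <= z < B%:Z - (T + 2)%:Z)%R -> coord z%:~R%R = z.
Proof.
move=> lt_z; rewrite /coord; have [a Ea] : exists a : nat, (z + (T + 2)%:Z =
  a%:Z)%R.
  by exists (absz (z + Posz (T + 2))%R); lia.
have -> : (z%:~R + (T + 2)%:R = a%:R :> Z)%R.
  by rewrite -[a%:R%R]/((Posz a)%:~R)%R -Ea intrD.
rewrite Z_val; lia.
Qed.

Lemma eq_coord (h : int) p : (- (T + 2)%:Z <= h < B%:Z - (T + 2)%:Z)%R ->
  (h == coord p) = (h%:~R%R == p).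
Proof.
by move=> lt_h; apply/eqP/eqP => [->|<-]; rewrite ?coordK ?coordE.
Qed.

Lemma coord_nat j : j + T + 2 < B -> coord j%:R%R = Posz j.
Proof. by move=> lt_j; rewrite -[j%:R%R]/((Posz j)%:~R)%R coordE //; lia. Qed.

Definition obs_of (C : config M) : observed := [ffun i =>
  ctape C i (chead C i)].
Definition cell_of (C : config M) (a : option action) (p : Z) : cell :=
  ((cstate C, obs_of C, a),
   ([ffun i => ctape C i (coord p)], [ffun i => chead C i == coord p])).
Definition move_on (C : config M) (a : option action) :=
  if a is Some b then step C b else C.
Definition near_origin (C : config M) :=
  forall i, (- T%:Z <= chead C i <= T%:Z)%R.

(** A head within [-T, T] stays in the range of [coord] after one more move, and there congruent
    positions are equal. So the head marks of the three cells determine whether the head arrives at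
    p. *)
Lemma evolves_cell C a p d : near_origin C ->
  evolves (cell_of C a (p - 1)%R) (cell_of C a p) (cell_of C a (p + 1)%R) d =
  (d.1.1.1 == cstate (move_on C a)) && (d.2 == (cell_of (move_on C a) None
    p).2).
Proof.
move=> nC; rewrite /evolves /=; case: a => [b|] //=; congr (_ && (_ == _)).
congr pair; apply/ffunP=> i; rewrite !ffunE /=; first by rewrite eq_sym.
have := nC i; set h := chead C i => lt_h; rewrite /shift.
case: (b.2 i).2; rewrite ?ffunE // -/h !eq_coord; try lia.
  by rewrite rmorphB /= subr_eq.
by rewrite rmorphD /= -subr_eq opprK eq_sym -subr_eq eq_sym.
Qed.

(** [take] stops at the end of [s], so that the last configuration is repeated from then on. *)
Definition cfg (s : seq action) t := foldl step (init M w) (take t s).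

Definition tableau_of (s : seq action) : tableau :=
  [ffun x : Z * Z => cell_of (cfg s x.1) (onth s x.1) x.2].

Lemma cfg0 s : cfg s 0 = init M w. Proof. by rewrite /cfg take0. Qed.

Lemma tableau_ofE s (t p : Z) :
  tableau_of s (t, p) = cell_of (cfg s t) (onth s t) p.
Proof. by rewrite ffunE. Qed.

Lemma init_coord p i :
  ctape (init M w) i (coord p) = if i == ord0 then
    string_on (blank M) (map (@letter _ M) w) (coord p) else blank M.
Proof. by rewrite /=; case: eqP. Qed.

Lemma cfg_near s t : size s <= T -> near_origin (cfg s t).
Proof.
move=> le_s i; have := @chead_foldl _ M (init M w) (take t s) i 0 isT.
have : size (take t s) <= size s by rewrite size_take; case: ltnP => // /ltnW.
rewrite /cfg; lia.
Qed.

Lemma cfgS s t : cfg s t.+1 = move_on (cfg s t) (onth s t).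
Proof.
rewrite /cfg; case: (ltnP t (size s)) => [lt_t|le_t]; last first.
  by rewrite onth_default // !take_oversize // leqW.
case Et: (onth s t) => [b|]; last by have := onthTE s t; rewrite Et lt_t.
by rewrite (take_nth b) // foldl_rcons (onth_nth _ _ _ _ Et).
Qed.

Lemma reads_of (tp : Z -> symbol M) (u : seq (symbol M)) z :
  reads tp z (blank M) u <->
  forall j, j <= size u -> tp (z + j%:R)%R = nth (blank M) u j.
Proof.
elim: u z => [|a u IH] z /=.
  split=> [/eqP Ez [|]// _|H]; rewrite ?addr0 //.
  by rewrite -[z]addr0 (H 0).
split=> [/andP[/eqP Ea /IH H] [|j]|H].
- by rewrite addr0.
- by rewrite ltnS => /H; rewrite -addrA -natr1 [(1 + _)%R]addrC.
apply/andP; split; first by rewrite -[z]addr0 (H 0).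
apply/IH => j le_j; have := H j.+1 le_j.
by rewrite -addrA -natr1 [(1 + _)%R]addrC.
Qed.

Lemma tableau_of_ok s : size s <= T -> accepting_run w s ->
  tableau_ok (tableau_of s).
Proof.
rewrite /accepting_run => le_s; case Es: (exec _ _) => [C|] // /andP[hC aC].
have [EC en] := (exec_foldl _ _ _).1 Es.
have cfg_end t : size s <= t -> cfg s t = C.
  by move=> le_t; rewrite /cfg take_oversize.
apply/andP; split; last first.
  apply/reads_of => j; rewrite size_map => le_j.
  rewrite !ffunE /cfg take0 [foldl _ _ _]/= add0r.
  by rewrite init_coord eqxx coord_nat //; lia.
apply/forallP=> t; apply/forallP=> p; rewrite !tableau_ofE.
have nt := @cfg_near s t le_s.
rewrite /window eqxx andTb; apply/and4P; split.
- apply/andP; split=> /=.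
    by apply/forallP=> i; rewrite !ffunE; apply/implyP=> /eqP<-.
  case Et: (onth s t) => [b|]; first exact: en Et.
  have le_t : size s <= t by rewrite -onthNE Et.
  by rewrite cfg_end //; apply/andP; split; [exact: hC | exact: aC].
- rewrite Z_S0 evolves_cell //; case: eqVneq => // ne_t; rewrite orFb.
  have -> : ((t + 1)%R : Z) = t.+1 :> nat.
    rewrite [t in LHS]Z_nat natr1 Z_val //.
    by have := Z_lt t; rewrite leq_eqVlt (negbTE ne_t).
  by rewrite cfgS !eqxx.
- apply/implyP=> /eqP->; rewrite cfg0 /initial eqxx andTb.
  apply/forallP=> i; rewrite !ffunE init_coord eq_coord; last by rewrite /=;
    lia.
  rewrite [chead _ _]/= mulr0z [(0 == p)%R]eq_sym eqxx andTb.
  by case: (i =P ord0) => //= _; rewrite eqxx.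
apply/implyP=> /and3P[/eqP-> p0]; rewrite cfg0 !ffunE !init_coord eqxx.
have string_on_blank z : string_on (blank M) (map (@letter _ M) w) z = blank M
  <->
    (z < 0 \/ (size w)%:Z <= z)%R.
  case: z => z /=; last by split=> // _; left.
  case: (ltnP z (size w)) => lt_z.
    split; last by case; lia.
    case: w lt_z => // a w' lt_z; rewrite (nth_map a) // => /eqP.
    by rewrite (negbTE (letter_blank _ _)).
  by rewrite nth_default ?size_map //; split=> // _; right; lia.
(* From p - 1 to p the coordinate either grows by 1 or wraps around to -(T + 2). As p is not 0, a
   cell outside the input is followed by a cell outside the input in both cases. *)
have Ep : (coord p = coord (p - 1) + 1)%R \/ (coord p < 0)%R.
  have Ep : p = (coord (p - 1) + 1)%:~R%R by rewrite rmorphD /= coordK subrK.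
  have := coord_ge (p - 1)%R; have := coord_lt (p - 1)%R => lt1 ge1.
  have [lt2|ge2] := boolP (coord (p - 1) + 1 < B%:Z - (T + 2)%:Z)%R.
    by left; rewrite {1}Ep coordE //; lia.
  right; have -> : p = (- (T + 2)%:Z)%:~R%R; last by rewrite coordE; lia.
  rewrite {1}Ep (_ : coord (p - 1) + 1 = B%:Z - (T + 2)%:Z)%R; last by lia.
  by rewrite rmorphB /= -pmulrn pchar_Zp // sub0r rmorphN.
have p_neq0 : coord p <> 0%R.
  by move=> E0; move: p0; rewrite -(coordK p) E0 eqxx.
move=> /eqP/string_on_blank H; apply/eqP/string_on_blank.
case: Ep H p_neq0; lia.
Qed.

Lemma Z_const (X : Type) (f : Z -> X) :
  (forall p, f (p - 1)%R = f p) -> forall p, f p = f 0%R.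
Proof.
move=> fP p; rewrite [p]Z_nat; elim: (p : nat) => // j <-.
by rewrite -fP -natr1 addrK.
Qed.

(** * From a tableau to the run that it describes *)

Section Decode.
Variables (tab : tableau).
Hypothesis tabP : forall t p, window (t == 0)%R (t + 1 == 0)%R (p == 0)%R
  (tab (t, p - 1)%R) (tab (t, p)) (tab (t, p + 1)%R) (tab (t + 1, p)%R).
Hypothesis tab_in :
  reads (fun p => (tab (0, p)%R).2.1 ord0) 0%R (blank M) (map (@letter _ M) w).
Hypothesis time_w : forall s, exec (init M w) s -> size s <= T.

Definition act_at (t : nat) := (tab (t%:R, 0)%R).1.2.

(** The part of a row that is forced by the row before it. The symbols read are recovered in
    [row_cell]; the action is the nondeterministic choice. *)
Definition row_is (t : nat) (C : config M) := forall p,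
  (tab (t%:R, p)%R).1.1.1 = cstate C /\
  (tab (t%:R, p)%R).2 = (cell_of C None p).2.

(** The first component is constant along the row by [Z_const]. At the position of head i, which
    [near_origin] puts in the range of [coord], [legal] compares the i-th symbol claimed to be read
    with the contents of the cell. *)
Lemma row_cell t C p : near_origin C -> row_is t C ->
  tab (t%:R, p)%R = cell_of C (act_at t) p.
Proof.
move=> nC row; have glob q : (tab (t%:R, q)%R).1 = (tab (t%:R, 0)%R).1.
  apply: (Z_const (f := fun q => (tab (t%:R, q)%R).1)) => {}q.
  by have /and5P[/eqP] := tabP t%:R%R q.
have Eg : (tab (t%:R, 0)%R).1.1.2 = obs_of C.
  apply/ffunP=> i; rewrite ffunE; pose q : Z := (chead C i)%:~R%R.
  have Eq : coord q = chead C i by rewrite coordE //; have := nC i; lia.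
  have /and5P[_ /andP[/forallP/(_ i) + _] _ _ _] := tabP t%:R%R q.
  rewrite (row q).2 /= !ffunE Eq eqxx /= => /eqP->; by rewrite (glob q).
have := row p; have := (row 0%R).1; have := glob p.
rewrite /cell_of -Eg /act_at; case: (tab (_, p)%R) => g1 [s1 h1] /= ->.
by case: (tab _).1 => [[? ?] ?] /= -> [_ [-> ->]].
Qed.

Lemma row0 : row_is 0 (init M w).
Proof.
move=> p; have /and5P[_ _ _ /implyP/(_ (eqxx _))] := tabP 0%R p.
case/andP=> /eqP-> /forallP H _; split=> //.
rewrite [LHS]surjective_pairing; congr pair; apply/ffunP=> i.
  rewrite ffunE init_coord; case: eqVneq => [->|i0]; last first.
    by have /andP[_] := H i; rewrite i0 => /eqP.
  have /reads_of := tab_in; rewrite size_map => rd.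
  (* The blank spreads from position |w| to B - 1; [window] exempts the step from there to position
     0. *)
  have rd_blank j : size w <= j < B -> (tab (0, j%:R)%R).2.1 ord0 = blank M.
    elim: j => [|j IH] /andP[le_j lt_j].
      have := rd 0 isT; rewrite add0r => ->; rewrite nth_default ?size_map //.
    move: le_j; rewrite leq_eqVlt => /orP[/eqP Ej|le_j].
      have := rd j.+1; rewrite -Ej add0r => -> //.
      by rewrite nth_default ?size_map.
    have /and5P[_ _ _ _ /implyP] := tabP 0%R j.+1%:R%R.
    have -> : (j.+1%:R - 1 = j%:R :> Z)%R by rewrite -natr1 addrK.
    rewrite Z_eq0 // eqxx /= => /(_ _)/eqP; apply.
    by rewrite IH // -ltnS le_j ltnW.
  rewrite {1}[p]Z_nat; case: (ltnP p (size w)) => [lt_p|le_p].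
    have := rd p (ltnW lt_p); rewrite add0r => ->.
    by rewrite [p in RHS]Z_nat coord_nat //; lia.
  rewrite rd_blank; last by rewrite le_p Z_lt.
  case Ec: (coord p) => [j|j] //=; rewrite nth_default // size_map.
  suff -> : j = p by [].
  by rewrite -(Z_val (j := j)) -?[j%:R%R]/((Posz j)%:~R)%R -?Ec ?coordK //;
    have := coord_lt p; lia.
rewrite ffunE; have /andP[/eqP-> _] := H i.
by rewrite eq_coord /=; [rewrite eq_sym | lia].
Qed.

Lemma row_next t C : t.+1 < B -> near_origin C -> row_is t C ->
  row_is t.+1 (move_on C (act_at t)).
Proof.
move=> lt_t nC row p; have /and5P[_ _ + _ _] := tabP t%:R%R p.
rewrite natr1 Z_eq0 //= !(row_cell _ nC row) evolves_cell //.
by case/andP=> /eqP-> /eqP->.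
Qed.

Lemma legal_act t C : near_origin C -> row_is t C ->
  if act_at t is Some b then b \in enabled C
  else halted C && (cstate C \in accept M).
Proof.
move=> nC row; have /and5P[_ /andP[_ +] _ _ _] := tabP t%:R%R 0%R.
by rewrite (row_cell _ nC row).
Qed.

Lemma exec_rcons C s b : exec (init M w) s = Some C -> b \in enabled C ->
  exec (init M w) (rcons s b) = Some (step C b).
Proof.
elim: s (init M w) => [|a s IH] D /=; first by case=> -> ->.
by case: ifP => // Da Es Cb; rewrite IH.
Qed.

Lemma near_exec s C : exec (init M w) s = Some C -> near_origin C.
Proof.
move=> Es; have := time_w (s := s); rewrite Es => /(_ isT) le_s.
have [<- _] := (exec_foldl _ _ _).1 Es.
by have := cfg_near (size s) le_s; rewrite /cfg take_size.
Qed.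

(** One induction for two facts that need each other: the recorded actions form a partial run, so
    that the time bound keeps the heads near the origin; and only then can the next row be decoded,
    which yields the next action of the run. *)
Lemma decode_row t : t < B -> exists2 C,
  exec (init M w) (pmap act_at (iota 0 t)) = Some C & row_is t C.
Proof.
elim: t => [|t IH] lt_t; first by exists (init M w); last exact: row0.
have [C EC row] := IH (ltnW lt_t).
have nC := near_exec EC; have := legal_act nC row => leg.
have := row_next lt_t nC row.
rewrite -addn1 iotaD pmap_cat /= add0n; exists (move_on C (act_at t)) => //.
move: leg; case: (act_at t) => [b|] /=; last by rewrite cats0.
by rewrite cats1; apply: exec_rcons.
Qed.

(** The configuration is halted and is repeated in the next row, where no action is enabled. *)
Lemma act_stable t : t.+1 < B -> act_at t = None -> act_at t.+1 = None.
Proof.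
move=> lt_t Et; have [C EC row] := decode_row (ltnW lt_t).
have [C' EC' row'] := decode_row lt_t.
have nC := near_exec EC.
move: EC'; rewrite -addn1 iotaD pmap_cat /= add0n Et cats0 EC => -[EC'].
rewrite -EC' in row'.
have := legal_act nC row; rewrite Et => /andP[hC _].
have := legal_act nC row'; rewrite addn1; case: (act_at t.+1) => // b.
by rewrite (eqP hC) inE.
Qed.

Lemma decode_run : exists s,
  [/\ size s <= T, accepting_run w s & tableau_of s = tab].
Proof.
have [u le_u Eu] := stable_onth act_stable.
have Etake t : t < B -> pmap act_at (iota 0 t) = take t u.
  elim: t => [|t IH] lt_t; first by rewrite take0.
  rewrite -addn1 iotaD pmap_cat IH; last exact: ltnW.
  rewrite /= add0n Eu; last exact: ltnW.
  case: (ltnP t (size u)) => lt_u; last first.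
    by rewrite onth_default //= cats0 !take_oversize // addn1 leqW.
  case E: (onth u t) => [b|]; last by have := onthTE u t; rewrite E lt_u.
  by rewrite addn1 (take_nth b) // (onth_nth _ _ _ _ E) cats1.
have rows t : t < B -> exec (init M w) (take t u) = Some (cfg u t) /\
    row_is t (cfg u t).
  move=> lt_t; have [C EC row] := decode_row lt_t; rewrite Etake // in EC.
  by have [EC' _] := (exec_foldl _ _ _).1 EC; rewrite /cfg EC'.
(* The prefix of length B - 1 is a partial run and thus has at most T < B - 1 steps. So [u] ends
   before the last row, and row [size u] exists to certify acceptance. *)
have le_uT : size u <= T.
  have lt1 : B.-1 < B by lia.
  have [E1 _] := rows _ lt1; have := time_w (s := take B.-1 u).
  rewrite E1 => /(_ isT); rewrite size_take; case: ltnP => //; lia.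
exists u; split=> //.
  have lt_u : size u < B by lia.
  have [Ex row] := rows _ lt_u; have nC := near_exec Ex.
  rewrite take_size in Ex; rewrite /accepting_run Ex.
  by have := legal_act nC row; rewrite Eu // onth_default.
apply/ffunP=> -[t p]; rewrite ffunE /=.
have [Ex row] := rows t (Z_lt t); have nC := near_exec Ex.
by rewrite -Eu ?Z_lt // -(row_cell _ nC row) natr_Zp.
Qed.
End Decode.

Lemma tableau_of_inj s s' : size s <= T -> size s' <= T ->
  tableau_of s = tableau_of s' -> s = s'.
Proof.
move=> le_s le_s' E; apply: eq_from_onth_le => t lt_t.
have lt_B : t < B by move: lt_t; rewrite /maxn; case: ifP; lia.
have /ffunP/(_ (t%:R, 0)%R) := E; rewrite !ffunE /= !Z_val //.
by case.
Qed.

Theorem card_tableaux :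
  (forall s, exec (init M w) s -> size s <= T) ->
  #|[set tab | tableau_ok tab]| =
  #|[set s : T.-bseq action | accepting_run w s]|.
Proof.
move=> time_w; rewrite -(card_in_imset (f := fun s : T.-bseq _ =>
  tableau_of s)).
  apply: eq_card => tab; rewrite inE; apply/idP/imsetP => [|[s]]; last first.
    by rewrite inE => acc ->; apply: tableau_of_ok acc; apply: size_bseq.
  case/andP=> /forallP tabP tab_in.
  have [t p|//|//|s [le_s acc Es]] := @decode_run tab.
    exact: (forallP (tabP t)).
  by exists (Bseq le_s); rewrite ?inE.
by move=> s s' _ _ /tableau_of_inj E; apply/val_inj/E; apply: size_bseq.
Qed.
End Tableaux.

(** * Formulas about blocks of variables *)

Section Satisfaction.
Variables (tau : vocabulary) (D : finType) (S : structure tau D).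

Lemma sat_free_vars f (e e' : nat -> option D) :
  {in free_vars f, e =1 e'} -> sat S e f = sat S e' f.
Proof.
elim: f e e' => [x y|r xs|f IH|f IHf g IHg|f IHf g IHg|f IHf g IHg|x f IH|x f
  IH]
  e e' /= H.
- by rewrite !H // !inE eqxx ?orbT.
- by case: insub => // i; apply: eq_existsb => t; congr (_ && (_ == _));
  apply/eq_in_map.
- by rewrite (IH e e').
- by rewrite (IHf e e') 1?(IHg e e') // => y yf; apply: H;
  rewrite mem_cat yf ?orbT.
- by rewrite (IHf e e') 1?(IHg e e') // => y yf; apply: H;
  rewrite mem_cat yf ?orbT.
- by rewrite (IHf e e') 1?(IHg e e') // => y yf; apply: H;
  rewrite mem_cat yf ?orbT.
- apply: eq_forallb => d; apply: IH => y yf; rewrite /assign.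
  by case: eqP => // /eqP yx; apply: H; rewrite mem_filter yx.
- apply: eq_existsb => d; apply: IH => y yf; rewrite /assign.
  by case: eqP => // /eqP yx; apply: H; rewrite mem_filter yx.
Qed.

(** Membership of plain lists, whose type does not depend on the arity; a list of the wrong length
    belongs to no relation. *)
Definition rel_mem (r : nat) (v : seq D) : bool :=
  if insub r is Some i then [exists t in S i, tval t == v] else false.

Lemma sat_Rel e r xs v : map e xs = map Some v -> sat S e (Rel r xs) = rel_mem r
  v.
Proof.
move=> /= ->; rewrite /rel_mem; case: insub => // i; apply: eq_existsb => t.
by congr (_ && _); apply/eqP/eqP => [|->//]; apply: inj_map => ? ? [].
Qed.

Definition assigns (e : nat -> option D) (xs : seq nat) (vs : seq D) :=
  foldl (fun e xv => assign e xv.1 xv.2) e (zip xs vs).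

Lemma sat_Alls xs f e : sat S e (foldr All f xs) <->
  forall vs, size vs = size xs -> sat S (assigns e xs vs) f.
Proof.
elim: xs e => [|x xs IH] e /=.
  by split=> [H [|]//|/(_ [::] erefl)].
split=> [/forallP H [|d vs] //= [szv]|H].
  by apply: (IH _).1 szv; apply: H.
by apply/forallP=> d; apply/IH => vs szv; apply: (H (d :: vs)); rewrite /= szv.
Qed.

Lemma assignsE d0 e xs vs y : uniq xs -> size vs = size xs ->
  assigns e xs vs y = if y \in xs then Some (nth d0 vs (index y xs)) else e y.
Proof.
rewrite /assigns; elim: xs e vs => [|x xs IH] e [|v vs] //= /andP[xxs ux] [sz].
rewrite IH // inE [x == y]eq_sym /assign; case: (eqVneq y x) => [->|] //=.
by rewrite (negbTE xxs).
Qed.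

End Satisfaction.

Lemma structure_ext tau (D : finType) (S S' : structure tau D) :
  (forall r v, r < size tau -> size v = nth 0 tau r ->
     rel_mem S r v = rel_mem S' r v) -> S = S'.
Proof.
have memE (U : structure tau D) (i : 'I_(size tau)) (t :
  (nth 0 tau i).-tuple D) :
    rel_mem U i t = (t \in U i).
  rewrite /rel_mem valK; apply/existsP/idP =>
    [[t' /andP[Ut' /eqP/val_inj<-]]|Ut] //.
  by exists t; rewrite Ut /=.
move=> E; apply/ffunP=> i; apply/setP=> t; rewrite -!memE E ?size_tuple //.
Qed.

(** * Binary numbers and the cyclic successor *)

Fixpoint num (s : seq bool) : nat := if s is b :: s' then b + (num s').*2 else
  0.

Lemma num_lt s : num s < 2 ^ size s.
Proof. by elim: s => //= b s IH; rewrite expnS; case: b; lia. Qed.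

Lemma num_inj s s' : size s = size s' -> num s = num s' -> s = s'.
Proof.
elim: s s' => [|b s IH] [|b' s'] //= [sz] E.
have [E1 E2] : b = b' /\ num s = num s' by case: b b' E => -[]; lia.
by rewrite E1 (IH s').
Qed.

Fixpoint carry (c : bool) (s s' : seq bool) : bool :=
  match s, s' with
  | b :: t, b' :: t' => (b' == b (+) c) && carry (b && c) t t'
  | _, _ => true
  end.

Lemma modn_double x K (b : bool) : 0 < K ->
  (b + x.*2) %% K.*2 = b + (x %% K).*2.
Proof.
move=> K0; rewrite {1}(divn_eq x K) doubleD doubleMr addnCA modnMDl modn_small
  //.
by have := ltn_pmod x K0; case: b; lia.
Qed.

Lemma carryE c s s' : size s = size s' ->
  carry c s s' = (num s + c == num s' %[mod 2 ^ size s]).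
Proof.
elim: s s' c => [|b s IH] [|b' s'] c //= => [_|[sz]].
  by rewrite !modn1.
have -> : b + (num s).*2 + c = (b (+) c) + (num s + (b && c)).*2.
  by case: b c => -[]; rewrite /=; lia.
rewrite expnS mul2n !modn_double ?expn_gt0 // IH //.
move: (_ %% _) (_ %% _) => x y; case: (b (+) c) b' => -[] /=; lia.
Qed.

(** A number [s'] is the cyclic successor of [s] iff the lowest bits differ and
    bit [j + 1] changes exactly when bit [j] changes from 1 to 0. *)
Definition carry_local (s s' : seq bool) (j : nat) : bool :=
  (nth false s j.+1 == nth false s' j.+1) == (nth false s j ==> nth false s' j).

(** Bit j of the sum is the exclusive or of bit j with the incoming carry. Hence the outgoing carry
    can be read off from the two bits, and carries need not be quantified. *)
Lemma carry_localE c s s' k : size s = k.+1 -> size s' = k.+1 ->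
  carry c s s' = ((nth false s' 0 == nth false s 0 (+) c) &&
    all (carry_local s s') (iota 0 k)).
Proof.
elim: k s s' c => [|k IH] [|b s] [|b' s'] c //= [sz] [sz'].
  by case: s s' sz sz' => [|//] [|//]; rewrite !andbT.
case E: (_ == _) => //=; rewrite (IH s s') // -[1]addn0 iotaDl all_map;
  congr (_ && _).
rewrite /carry_local /=; move/eqP: E => ->.
by case: (nth _ s 0) (nth _ s' 0) b c => -[] [] [].
Qed.

(** Formulas about numbers modulo 2^m with one variable per number. Their syntax does not involve m,
    so that each can be interpreted over numbers ([holds]), expanded into bits ([form_of]) and
    printed by a program of fixed size. *)
Inductive tmpl :=
| tTrue
| tCell (r b b' : nat)
| tZero (b : nat)
| tSucc (b b' : nat)
| tSame (b b' : nat)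
| tNeg (f : tmpl)
| tAnd (f g : tmpl)
| tImp (f g : tmpl)
| tAll (b : nat) (f : tmpl).

Section Blocks.
Variable m : nat.

(** Block [b] consists of the variables [b * m], ..., [b * m + m - 1], which
    are the bits of a number, beginning with the lowest one; the unary relation
    0 holds for the element that represents the bit 1. *)
Definition var (b j : nat) := b * m + j.
Definition block_vars b := [seq var b j | j <- iota 0 m].
Definition true_form := All 0 (Eq 0 0).
Definition all_block b f := foldr (fun j g => All (var b j) g) f (iota 0 m).
Definition conj_upto (G : nat -> form) k :=
  foldr (fun j g => And (G j) g) true_form (iota 0 k).
Definition carry_form b b' j :=
  let E := Eq (var b j.+1) (var b' j.+1) in
  let F := Imp (Rel 0 [:: var b j]) (Rel 0 [:: var b' j]) in
  And (Imp E F) (Imp F E).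

Fixpoint form_of (f : tmpl) : form :=
  match f with
  | tTrue => true_form
  | tCell r b b' => Rel r (block_vars b ++ block_vars b')
  | tZero b => conj_upto (fun j => Neg (Rel 0 [:: var b j])) m
  | tSucc b b' => And (Neg (Eq (var b 0) (var b' 0)))
                      (conj_upto (carry_form b b') m.-1)
  | tSame b b' => conj_upto (fun j => Eq (var b j) (var b' j)) m
  | tNeg f => Neg (form_of f)
  | tAnd f g => And (form_of f) (form_of g)
  | tImp f g => Imp (form_of f) (form_of g)
  | tAll b f => all_block b (form_of f)
  end.

Section Holds.
Variable R : nat -> 'Z_(2 ^ m) -> 'Z_(2 ^ m) -> bool.
Fixpoint holds (z : nat -> 'Z_(2 ^ m)) (f : tmpl) : bool :=
  match f with
  | tTrue => true
  | tCell r b b' => R r (z b) (z b')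
  | tZero b => z b == 0%R
  | tSucc b b' => z b' == (z b + 1)%R
  | tSame b b' => z b == z b'
  | tNeg f => ~~ holds z f
  | tAnd f g => holds z f && holds z g
  | tImp f g => holds z f ==> holds z g
  | tAll b f => [forall v, holds (fun c => if c == b then v else z c) f]
  end.

Lemma holds_all z b f : holds z (tAll b f) =
  [forall v, holds (fun c => if c == b then v else z c) f].
Proof. by []. Qed.
Lemma holds_and z f g : holds z (tAnd f g) = holds z f && holds z g.
Proof. by []. Qed.
Lemma holds_imp z f g : holds z (tImp f g) = (holds z f ==> holds z g).
Proof. by []. Qed.
Lemma holds_neg z f : holds z (tNeg f) = ~~ holds z f.
Proof. by []. Qed.
Lemma holds_cell z r b b' : holds z (tCell r b b') = R r (z b) (z b').
Proof. by []. Qed.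
Lemma holds_zero z b : holds z (tZero b) = (z b == 0%R).
Proof. by []. Qed.
Lemma holds_succ z b b' : holds z (tSucc b b') = (z b' == z b + 1)%R.
Proof. by []. Qed.
Lemma holds_same z b b' : holds z (tSame b b') = (z b == z b').
Proof. by []. Qed.
End Holds.
Definition holdsE := (holds_and, holds_imp, holds_neg, holds_cell, holds_zero,
  holds_succ, holds_same).

Hypothesis m0 : 0 < m.

Lemma two_pow_gt1 : 1 < 2 ^ m.
Proof. by case: m m0 => // k _; rewrite expnS; have := expn_gt0 2 k; lia. Qed.

Lemma mem_block b y : (y \in iota (b * m) m) = (y %/ m == b).
Proof.
rewrite mem_iota; apply/idP/eqP => [/andP[le_y lt_y]|<-].
  by rewrite -(subnKC le_y) divnMDl // divn_small ?addn0 // ltn_subLR.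
by rewrite leq_trunc_div /= {1}(divn_eq y m) ltn_add2l ltn_pmod.
Qed.

Lemma index_block y : index y (iota (y %/ m * m) m) = y %% m.
Proof.
rewrite {1}(divn_eq y m) -(nth_iota 0 (y %/ m * m) (ltn_pmod y m0)).
by rewrite index_uniq ?iota_uniq ?size_iota ?ltn_pmod.
Qed.

Section Code.
Variable u : 'I_2.

Definition bits (v : seq 'I_2) : seq bool := map (eq_op u) v.
Definition code (v : seq 'I_2) : 'Z_(2 ^ m) := (num (bits v))%:R%R.

(** This is where the domain having two elements matters: an element is determined by whether it
    equals [u]. *)
Lemma bit_inj : injective (eq_op u).
Proof.
move=> x y; rewrite -!val_eqE /= => E; apply: val_inj; move: E.
by case: u x y => [[|[|?]] ?] [[|[|?]] ?] [[|[|?]] ?].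
Qed.

Lemma code_val v : size v = m -> code v = num (bits v) :> nat.
Proof.
move=> sv; rewrite /code val_Zp_nat ?two_pow_gt1 // modn_small //.
by rewrite -[m in X in _ < X]sv -(size_map (eq_op u)) num_lt.
Qed.

Lemma code_inj v v' : size v = m -> size v' = m -> code v = code v' -> v = v'.
Proof.
move=> sv sv' /(congr1 (@nat_of_ord _)); rewrite !code_val // => E.
by apply: (inj_map bit_inj); apply: num_inj E; rewrite !size_map sv sv'.
Qed.

Lemma code_surj z : exists2 v : m.-tuple 'I_2, code v = z & true.
Proof.
have inj : injective (fun v : m.-tuple 'I_2 => code v).
  by move=> v v' /code_inj E; apply: val_inj; apply: E; apply: size_tuple.
have [|g _ gK] := inj_card_bij inj; last by exists (g z).
by rewrite card_tuple !card_ord [X in X <= _](Zp_cast two_pow_gt1).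
Qed.

Definition decode_bits (z : 'Z_(2 ^ m)) : m.-tuple 'I_2 :=
  odflt [tuple of nseq m u] [pick v : m.-tuple 'I_2 | code v == z].

Lemma decode_bitsK z : code (decode_bits z) = z.
Proof.
rewrite /decode_bits; case: pickP => [v /eqP->|none] //=.
by have [v E _] := code_surj z; have := none v; rewrite E eqxx.
Qed.

Lemma codeK (v : m.-tuple 'I_2) : decode_bits (code v) = v.
Proof.
by apply: val_inj; apply: code_inj; rewrite ?size_tuple // decode_bitsK.
Qed.

Lemma code_eq0 (v : m.-tuple 'I_2) : (code v == 0%R) = all (fun d => u != d) v.
Proof.
rewrite -val_eqE /= code_val ?size_tuple //; elim: (tval v) => //= d s <-.
by case: (u =P d) => //= _; rewrite ?add0n double_eq0.
Qed.

Lemma code_eq (v v' : m.-tuple 'I_2) : (code v == code v') = (v == v').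
Proof.
apply/eqP/eqP => [E|->//]; by rewrite -(codeK v) E codeK.
Qed.

Lemma code_succ (v v' : m.-tuple 'I_2) :
  (code v' == code v + 1)%R =
  (nth false (bits v') 0 != nth false (bits v) 0) &&
  all (carry_local (bits v) (bits v')) (iota 0 m.-1).
Proof.
have sb (t : m.-tuple 'I_2) : size (bits t) = m.-1.+1.
  by rewrite size_map size_tuple prednK.
have -> : (code v' == code v + 1)%R = carry true (bits v) (bits v').
  rewrite carryE ?sb // prednK // /code natr1 addn1 eq_sym -val_eqE /=.
  by rewrite !val_Zp_nat ?two_pow_gt1.
rewrite (carry_localE _ (sb v) (sb v')); congr (_ && _).
by case: (nth _ _ _) (nth _ _ _) => -[].
Qed.

End Code.

Section Models.
Variables (tau : vocabulary) (S : structure tau 'I_2) (u : 'I_2).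
Hypothesis unit_u : forall d, rel_mem S 0 [:: d] = (u == d).

Definition valuation (rho : nat -> m.-tuple 'I_2) (y : nat) : option 'I_2 :=
  Some (nth u (rho (y %/ m)) (y %% m)).

Lemma valuation_var rho b j : j < m -> valuation rho (var b j) = Some (nth u
  (rho b) j).
Proof.
by move=> lt_j; rewrite /valuation /var divnMDl // divn_small // addn0 modnMDl
  modn_small.
Qed.

Lemma valuation_block rho b :
  map (valuation rho) (block_vars b) = map Some (rho b).
Proof.
rewrite -map_comp -[in RHS](mkseq_nth u (rho b)) size_tuple /mkseq -map_comp.
by apply/eq_in_map => j; rewrite mem_iota => /andP[_ lt_j] /=;
  rewrite valuation_var.
Qed.

Lemma sat_conj_upto e G k :
  sat S e (conj_upto G k) = all (fun j => sat S e (G j)) (iota 0 k).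
Proof.
rewrite /conj_upto; elim: (iota 0 k) => [|j s IH] /=; last by rewrite IH.
by apply/forallP => d.
Qed.

Lemma sat_all_block rho b f : sat S (valuation rho) (all_block b f) =
  [forall v : m.-tuple 'I_2,
     sat S (valuation (fun c => if c == b then v else rho c)) f].
Proof.
have -> : all_block b f = foldr All f (iota (b * m) m).
  by rewrite /all_block -[b * m]addn0 iotaDl foldr_map.
have E (v : m.-tuple 'I_2) : assigns (valuation rho) (iota (b * m) m) v =
    valuation (fun c => if c == b then v else rho c).
  apply: functional_extensionality => y.
  rewrite (assignsE u) ?iota_uniq ?size_iota ?size_tuple // mem_block
    /valuation.
  by case: eqP => // <-; rewrite index_block.
apply/idP/forallP => [/sat_Alls H v|H].
  by rewrite -E; apply: H; rewrite size_tuple size_iota.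
apply/sat_Alls => vs; rewrite size_iota => /eqP sz.
by rewrite -[vs]/(tval (Tuple sz)) E.
Qed.

Definition coded_rel (r : nat) (z z' : 'Z_(2 ^ m)) : bool :=
  rel_mem S r (decode_bits u z ++ decode_bits u z').

Lemma sat_unary rho b j : j < m ->
  sat S (valuation rho) (Rel 0 [:: var b j]) = nth false (bits u (rho b)) j.
Proof.
move=> lt_j; rewrite (@sat_Rel _ _ S _ 0 _ [:: nth u (rho b) j]) /=; last first.
  by rewrite valuation_var.
by rewrite unit_u (nth_map u) // size_tuple.
Qed.

Lemma sat_carry_form e b b' j : sat S e (carry_form b b' j) =
  ((e (var b j.+1) == e (var b' j.+1)) ==
   (sat S e (Rel 0 [:: var b j]) ==> sat S e (Rel 0 [:: var b' j]))).
Proof.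
rewrite /carry_form; set E := Eq _ _; set F := Imp (Rel _ _) _.
rewrite -[LHS]/((sat S e E ==> sat S e F) && (sat S e F ==> sat S e E)).
rewrite -[_ ==> _ in RHS]/(sat S e F) -[e _ == _]/(sat S e E).
by case: (sat S e E) (sat S e F) => -[].
Qed.

Lemma sat_form_of f rho : sat S (valuation rho) (form_of f) =
  holds coded_rel (fun b => code u (rho b)) f.
Proof.
elim: f rho => [|r b b'|b|b b'|b b'|f IH|f IHf g IHg|f IHf g IHg|b f IH] rho.
- by apply/forallP=> d /=.
- rewrite (@sat_Rel _ _ S _ r _ (rho b ++ rho b')) ?map_cat ?valuation_block
  //=.
  by rewrite /coded_rel !codeK.
- rewrite /= sat_conj_upto code_eq0.
  rewrite -[in RHS](mkseq_nth u (rho b)) size_tuple all_map.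
  apply: eq_in_all => j; rewrite mem_iota => /andP[_ lt_j].
  rewrite -[sat _ _ _]/(~~ sat S (valuation rho) (Rel 0 [:: var b j])) sat_unary
    //.
  by rewrite (nth_map u) // size_tuple.
- rewrite [LHS]/= sat_conj_upto [RHS]/= code_succ; congr (_ && _).
    rewrite !valuation_var // (inj_eq (@Some_inj _)) eq_sym.
    by rewrite !(nth_map u) ?size_tuple // (inj_eq (@bit_inj u)).
  apply: eq_in_all => j; rewrite mem_iota => /andP[_ lt_j].
  have lt_j1 : j.+1 < m by lia.
  rewrite sat_carry_form !sat_unary 1?ltnW // !valuation_var // /carry_local.
  rewrite (inj_eq (@Some_inj _)) -(inj_eq (@bit_inj u)).
  by rewrite !(nth_map u) ?size_tuple // ltnW.
- rewrite /= sat_conj_upto code_eq -val_eqE /=.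
  rewrite -[val (rho b)](mkseq_nth u) -[val (rho b')](mkseq_nth u) !size_tuple.
  apply/allP/eqP => [H|E j].
    apply/eq_in_map => j lt_j; have := H j lt_j; move: lt_j.
    by rewrite mem_iota => /andP[_ lt_j] /=;
      rewrite !valuation_var // => /eqP[].
  move/eq_in_map: E => E lt_j; have := E j lt_j; move: lt_j.
  by rewrite mem_iota => /andP[_ lt_j] /=; rewrite !valuation_var // => ->.
- by rewrite /= IH.
- by rewrite /= IHf IHg.
- by rewrite /= IHf IHg.
rewrite [LHS]/= sat_all_block; apply/forallP/forallP => /= H.
  move=> z; have := H (decode_bits u z); rewrite IH; congr (holds _ _ _).
  by apply: functional_extensionality => c; case: eqP => // _;
    rewrite decode_bitsK.
move=> v; rewrite IH; have := H (code u v); congr (holds _ _ _).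
by apply: functional_extensionality => c; case: eqP.
Qed.
End Models.

Fixpoint free_blocks (f : tmpl) : seq nat :=
  match f with
  | tTrue => [::]
  | tZero b => [:: b]
  | tCell _ b b' | tSucc b b' | tSame b b' => [:: b; b']
  | tNeg f => free_blocks f
  | tAnd f g | tImp f g => free_blocks f ++ free_blocks g
  | tAll b f => [seq c <- free_blocks f | c != b]
  end.

Lemma free_vars_conj_upto G k y : y \in free_vars (conj_upto G k) ->
  exists2 j, j < k & y \in free_vars (G j).
Proof.
rewrite /conj_upto => Hy; suff [j] : exists2 j, j \in iota 0 k & y \in free_vars
  (G j).
  by rewrite mem_iota => /andP[_ lt_j] yG; exists j.
elim: (iota 0 k) Hy => //= j s IH; rewrite mem_cat => /orP[yj|/IH[i si yi]].
  by exists j; rewrite ?inE ?eqxx.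
by exists i; rewrite ?inE ?si ?orbT.
Qed.

Lemma var_block b j : j < m -> var b j %/ m = b.
Proof. by move=> lt_j; rewrite /var divnMDl // divn_small ?addn0. Qed.

Lemma free_vars_form_of f y : y \in free_vars (form_of f) ->
  y %/ m \in free_blocks f.
Proof.
elim: f => [|r b b'|b|b b'|b b'|f IH|f IHf g IHg|f IHf g IHg|b f IH] //=.
- have bv c : y \in block_vars c -> y %/ m = c.
    case/mapP=> j; rewrite mem_iota => /andP[_ lt_j] ->; exact: var_block.
  by rewrite mem_cat !inE => /orP[]/bv->; rewrite eqxx ?orbT.
- by case/free_vars_conj_upto=> j lt_j; rewrite !inE => /eqP->;
  rewrite var_block.
- rewrite !inE => /or3P[/eqP->|/eqP->|/free_vars_conj_upto[j lt_j]].
  + by rewrite var_block ?eqxx.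
  + by rewrite var_block ?eqxx ?orbT.
  have lt_j1 : j.+1 < m by lia.
  by rewrite /= !inE; do !case/orP; move/eqP->;
    rewrite var_block ?eqxx ?orbT // ltnW.
- case/free_vars_conj_upto=> j lt_j; rewrite !inE => /orP[]/eqP->;
  by rewrite var_block ?eqxx ?orbT.
- by rewrite !mem_cat => /orP[/IHf|/IHg] ->; rewrite ?orbT.
- by rewrite !mem_cat => /orP[/IHf|/IHg] ->; rewrite ?orbT.
have fvA xs g : free_vars (foldr All g xs) =i
    [pred y | (y \notin xs) && (y \in free_vars g)].
  move=> x; elim: xs => //= x' xs IHx; rewrite mem_filter IHx !inE negb_or.
  by rewrite andbA.
have -> : all_block b (form_of f) = foldr All (form_of f) (iota (b * m) m).
  by rewrite /all_block -[b * m]addn0 iotaDl foldr_map.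
by rewrite fvA inE mem_block mem_filter => /andP[-> /IH].
Qed.

Fixpoint cells_in (R : nat) (f : tmpl) : bool :=
  match f with
  | tCell r _ _ => 0 < r <= R
  | tNeg f | tAll _ f => cells_in R f
  | tAnd f g | tImp f g => cells_in R f && cells_in R g
  | _ => true
  end.

Definition tau_of (R : nat) : vocabulary := 1 :: nseq R (m + m).

Lemma over_conj_upto tau G k : (forall j, over tau (G j)) -> over tau (conj_upto
  G k).
Proof. by move=> oG; rewrite /conj_upto; elim: (iota 0 k) => //= j s ->;
  rewrite oG. Qed.

Lemma over_form_of R f : cells_in R f -> over (tau_of R) (form_of f).
Proof.
elim: f => [|r b b'|b|b b'|b b'|f IH|f IHf g IHg|f IHf g IHg|b f IH] //=.
- case: r => // r /= lt_r; rewrite size_cat !size_map !size_iota size_nseq.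
  by rewrite /= ltnS nth_nseq lt_r eqxx.
- by move=> _; apply: over_conj_upto.
- by move=> _; apply: over_conj_upto.
- by move=> _; apply: over_conj_upto.
- by case/andP=> /IHf-> /IHg->.
- by case/andP=> /IHf-> /IHg->.
by move=> H; rewrite /all_block; elim: (iota 0 m) => //=; apply: IH.
Qed.

End Blocks.

(** * Counting tilings as models *)

Section Templates.
Variables (G : finType) (X : eqType) (proj : G -> X) (bl : X)
  (W : bool -> bool -> bool -> G -> G -> G -> G -> bool).

(** Shifted by one because symbol 0 is the unary relation that marks the bit 1. *)
Definition rank (g : G) : nat := (enum_rank g).+1.

Lemma eq_rank g h : (rank g == rank h) = (g == h).
Proof. by rewrite /rank eqSS -(inj_eq (@enum_rank_inj G)). Qed.

Definition big_and (s : seq tmpl) : tmpl := foldr tAnd tTrue s.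

Definition unique_cell : tmpl :=
  tAll 0 (tAll 2 (tAnd
    (tNeg (big_and [seq tNeg (tCell (rank g) 0 2) | g <- enum G]))
    (big_and [seq tNeg (tAnd (tCell (rank x.1) 0 2) (tCell (rank x.2) 0 2))
             | x : G * G <- enum {: G * G} & x.1 != x.2]))).

Definition sign (v : bool) (b : nat) : tmpl :=
  if v then tZero b else tNeg (tZero b).

(** A finite set independent of the input: [W] is expressed by excluding each pattern that it
    forbids, with a number of conjuncts that does not grow with m. *)
Definition pattern : finType := (bool * bool * bool * (G * G * G * G))%type.

Definition allowed (x : pattern) : bool :=
  let: (zt, zt', zp, (l, c, r, d)) := x in W zt zt' zp l c r d.

Definition match_pattern (x : pattern) : tmpl :=
  let: (zt, zt', zp, (l, c, r, d)) := x in
  tAnd (sign zt 0) (tAnd (sign zt' 1) (tAnd (sign zp 3)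
    (tAnd (tCell (rank l) 0 2) (tAnd (tCell (rank c) 0 3)
      (tAnd (tCell (rank r) 0 4) (tCell (rank d) 1 3)))))).

(** Blocks 0 and 1 contain t and t + 1; blocks 2, 3 and 4 contain p - 1, p and
    p + 1. *)
Definition all_windows : tmpl :=
  tAll 0 (tAll 1 (tAll 2 (tAll 3 (tAll 4
    (tImp (tSucc 0 1) (tImp (tSucc 2 3) (tImp (tSucc 3 4)
      (big_and [seq tNeg (match_pattern x) | x : pattern <- enum pattern & ~~
        allowed x])))))))).

Definition is_symbol (a : X) : tmpl :=
  big_and [seq tNeg (tCell (rank g) 0 5) | g <- enum G & proj g != a].

(** The position is in block 5; requantifying it after having moved its
    successor to block 6 makes two blocks sufficient for inputs of any length.
      *)
Fixpoint reading (u : seq X) : tmpl :=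
  if u is a :: u' then
    tAnd (is_symbol a)
      (tAll 6 (tImp (tSucc 5 6) (tAll 5 (tImp (tSame 6 5) (reading u')))))
  else is_symbol bl.

Definition input_row (u : seq X) : tmpl :=
  tAll 0 (tAll 5 (tImp (tZero 0) (tImp (tZero 5) (reading u)))).

(** Correct for domains with two elements only. *)
Definition exactly_one : form :=
  let U x := Rel 0 [:: x] in
  All 0 (All 1 (Or (Eq 0 1)
    (And (Imp (U 0) (Neg (U 1))) (Imp (Neg (U 0)) (U 1))))).

Variable m : nat.
Hypothesis m0 : 0 < m.
Notation Z := 'Z_(2 ^ m).

Definition sentence_of (u : seq X) : form :=
  And exactly_one (And (form_of m unique_cell)
    (And (form_of m all_windows) (form_of m (input_row u)))).

Definition vocabulary_of : vocabulary := tau_of m #|G|.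

Lemma cells_in_big_and (T : eqType) (F : T -> tmpl) s N :
  (forall x, cells_in N (F x)) -> cells_in N (big_and [seq F x | x <- s]).
Proof. by move=> H; elim: s => //= x s ->; rewrite H. Qed.

Lemma rank_in g : 0 < rank g <= #|G|.
Proof. by rewrite /rank /= ltn_ord. Qed.

Lemma cells_in_unique : cells_in #|G| unique_cell.
Proof.
apply/andP; split; apply: cells_in_big_and => x; first exact: rank_in.
by apply/andP; split; apply: rank_in.
Qed.

Lemma cells_in_windows : cells_in #|G| all_windows.
Proof.
apply: cells_in_big_and => -[[[zt zt'] zp] [[[l c] r] d]].
rewrite /match_pattern; set N := #|G|.
have r_in g : cells_in N (tCell (rank g) 0 2) by apply: rank_in.
rewrite /= in r_in.
by rewrite /sign; case: zt zt' zp => -[] [] /=; rewrite !r_in.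
Qed.

Lemma cells_in_input u : cells_in #|G| (input_row u).
Proof.
have is_in a : cells_in #|G| (is_symbol a).
  by apply: cells_in_big_and => g; apply: rank_in.
by rewrite /=; elim: u => //= a u ->; rewrite is_in.
Qed.

Definition blocks_in (l : seq nat) (f : tmpl) : bool :=
  all (fun b => b \in l) (free_blocks f).

Lemma blocks_in_and l f g :
  blocks_in l (tAnd f g) = blocks_in l f && blocks_in l g.
Proof. by rewrite /blocks_in /= all_cat. Qed.

Lemma blocks_in_imp l f g :
  blocks_in l (tImp f g) = blocks_in l f && blocks_in l g.
Proof. by rewrite /blocks_in /= all_cat. Qed.

Lemma blocks_in_all l b f : blocks_in l (tAll b f) = blocks_in (b :: l) f.
Proof.
rewrite /blocks_in /= all_filter; apply: eq_all => c /=; rewrite inE.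
by case: eqP.
Qed.

Lemma blocks_in_big_and (T : eqType) (F : T -> tmpl) s l :
  (forall x, blocks_in l (F x)) -> blocks_in l (big_and [seq F x | x <- s]).
Proof. by move=> H; elim: s => //= x s IH; rewrite blocks_in_and H. Qed.

Lemma blocks_in_reading u l : 0 \in l -> blocks_in (5 :: l) (reading u).
Proof.
have is_in a l' : 0 \in l' -> 5 \in l' -> blocks_in l' (is_symbol a).
  by move=> h0 h5; apply: blocks_in_big_and => g; rewrite /blocks_in /= h0 h5.
elim: u l => [|a u IH] l l0 /=; first by rewrite is_in ?inE ?l0.
rewrite blocks_in_and is_in ?inE ?l0 //= blocks_in_all blocks_in_imp.
by rewrite blocks_in_all blocks_in_imp IH ?inE ?l0 ?orbT // andbT.
Qed.

Lemma free_vars_And f g : free_vars (And f g) = free_vars f ++ free_vars g.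
Proof. by []. Qed.

Lemma closed_sentence u y : y \notin free_vars (sentence_of u).
Proof.
have closed f : blocks_in [::] f -> y \notin free_vars (form_of m f).
  by move=> /allP H; apply/negP => /(free_vars_form_of m0)/H.
rewrite /sentence_of; do !rewrite free_vars_And mem_cat negb_or.
rewrite !closed //.
- rewrite /input_row !(blocks_in_all, blocks_in_imp) /blocks_in /=.
  by rewrite -/(blocks_in _ _) blocks_in_reading.
- rewrite /all_windows !(blocks_in_all, blocks_in_imp).
  apply/and4P; split=> //; apply: blocks_in_big_and =>
    -[[[zt zt'] zp] [[[l c] r] d]].
  by rewrite /blocks_in; case: zt zt' zp => -[] [].
rewrite /unique_cell !blocks_in_all blocks_in_and; apply/andP; split.
  exact: blocks_in_big_and.
exact: blocks_in_big_and.
Qed.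

Lemma over_And tau f g : over tau (And f g) = over tau f && over tau g.
Proof. by []. Qed.

Lemma sentence_sentence_of u : sentence vocabulary_of (sentence_of u).
Proof.
apply/andP; split.
  rewrite /sentence_of /vocabulary_of; set N := #|G|.
  do !rewrite over_And; rewrite !over_form_of //.
  - exact: cells_in_input.
  - exact: cells_in_windows.
  - exact: cells_in_unique.
have := closed_sentence u; case: (free_vars _) => // x s /(_ x).
by rewrite inE eqxx.
Qed.

Lemma holds_big_and R z (T : Type) (F : T -> tmpl) s :
  @holds m R z (big_and [seq F x | x <- s]) = all (fun x => holds R z (F x)) s.
Proof. by elim: s => //= x s ->. Qed.

Lemma holds_ext N R R' z f : cells_in N f ->
  (forall r t p, 0 < r <= N -> R r t p = R' r t p) ->
  @holds m R z f = holds R' z f.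
Proof.
move=> + RR'; elim: f z => [|r b b'|b|b b'|b b'|f IH|f IHf g IHg|f IHf g IHg|b f
  IH] z //=.
- exact: RR'.
- by move=> /IH->.
- by case/andP=> /IHf-> /IHg->.
- by case/andP=> /IHf-> /IHg->.
by move=> Hf; apply: eq_forallb => v; apply: IH.
Qed.

Definition tiling := {ffun Z * Z -> G}.
Definition tiling_rel (tab : tiling) (r : nat) (t p : Z) : bool :=
  r == rank (tab (t, p)).

Lemma holds_unique_cell R z : holds R z unique_cell ->
  exists tab : tiling, forall g t p, R (rank g) t p = tiling_rel tab (rank g) t
    p.
Proof.
rewrite /unique_cell holds_all => /forallP H.
have Htp t p : (exists g, R (rank g) t p) /\
    (forall g h, R (rank g) t p -> R (rank h) t p -> g = h).
  have := H t; rewrite holds_all => /forallP/(_ p).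
  rewrite holds_and holds_neg !holds_big_and => /andP[/allPn[g _ Eg] /allP U].
  split=> [|g1 g2 R1 R2]; first by exists g; move: Eg; rewrite !holdsE negbK.
  apply/eqP; apply/negPn/negP => ne; have := U (g1, g2).
  by rewrite mem_filter mem_enum ne !holdsE R1 R2 => /(_ isT).
pose tab : tiling := [ffun x => xchoose (Htp x.1 x.2).1].
exists tab => g t p; rewrite /tiling_rel eq_rank ffunE /=.
have Rx := xchooseP (Htp t p).1.
by apply/idP/eqP => [/((Htp t p).2 _ _)/(_ Rx)//|->].
Qed.

Lemma unique_cell_tiling tab z : holds (tiling_rel tab) z unique_cell.
Proof.
rewrite /unique_cell holds_all; apply/forallP=> t.
rewrite holds_all; apply/forallP=> p; rewrite holds_and holds_neg
  !holds_big_and.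
apply/andP; split.
  by apply/allPn; exists (tab (t, p)); rewrite ?mem_enum // !holdsE negbK
    /tiling_rel.
apply/allP=> -[g h]; rewrite mem_filter => /andP[ne _];
  rewrite !holdsE /tiling_rel.
by rewrite !eq_rank; apply: contraNN ne => /andP[/eqP-> /eqP->].
Qed.

Lemma holds_sign R z v b : @holds m R z (sign v b) = (v == (z b == 0%R)).
Proof. by case: v; rewrite /sign !holdsE; case: (_ == 0%R). Qed.

Lemma holds_windows tab z : holds (tiling_rel tab) z all_windows =
  [forall t : Z, forall p : Z,
     W (t == 0)%R (t + 1 == 0)%R (p == 0)%R
       (tab (t, p - 1)%R) (tab (t, p)) (tab (t, p + 1)%R) (tab (t + 1, p)%R)].
Proof.
rewrite /all_windows holds_all; apply/forallP/forallP => H t.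
  apply/forallP => p; have := H t; rewrite holds_all => /forallP/(_ (t + 1)%R).
  rewrite holds_all => /forallP/(_ (p - 1)%R);
    rewrite holds_all => /forallP/(_ p).
  rewrite holds_all => /forallP/(_ (p + 1)%R).
  rewrite !holds_imp !holds_succ !eqxx subrK !eqxx !implyTb holds_big_and.
  move=> /allP HW; apply/negPn/negP => NW.
  have := HW ((t == 0, t + 1 == 0, p == 0)%R,
    (tab (t, p - 1)%R, tab (t, p), tab (t, p + 1)%R, tab (t + 1, p)%R)).
  rewrite mem_filter mem_enum NW => /(_ isT).
  by rewrite holds_neg [match_pattern _]/= !holdsE !holds_sign /tiling_rel
    !eqxx.
rewrite holds_all; apply/forallP=> t'; rewrite holds_all; apply/forallP=> p0.
rewrite holds_all; apply/forallP=> p; rewrite holds_all; apply/forallP=> p1.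
rewrite !holds_imp !holds_succ /=.
apply/implyP=> /eqP->; apply/implyP=> /eqP Ep; apply/implyP=> /eqP->.
have {Ep p0} -> : p0 = (p - 1)%R by rewrite Ep addrK.
rewrite holds_big_and; apply/allP => -[[[zt zt'] zp] [[[l c] r] d]].
rewrite mem_filter mem_enum andbT => NW.
rewrite holds_neg [match_pattern _]/= !holdsE !holds_sign /= /tiling_rel
  !eq_rank.
apply: contraNN NW.
case/and5P=> /eqP-> /eqP-> /eqP-> /eqP-> /and3P[/eqP-> /eqP-> /eqP->].
exact: (forallP (H t)).
Qed.

Lemma holds_is_symbol tab z a :
  holds (tiling_rel tab) z (is_symbol a) = (proj (tab (z 0, z 5)) == a).
Proof.
rewrite holds_big_and; apply/allP/eqP => [H|E g].
  apply/eqP/negPn/negP => ne; have := H (tab (z 0, z 5)).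
  by rewrite mem_filter mem_enum ne !holdsE /tiling_rel eqxx => /(_ isT).
rewrite mem_filter mem_enum andbT !holdsE /tiling_rel eq_rank => ne.
by apply: contraNN ne => /eqP->; rewrite E.
Qed.

Lemma holds_reading tab z u : holds (tiling_rel tab) z (reading u) =
  reads (fun p => proj (tab (z 0, p))) (z 5) bl u.
Proof.
elim: u z => [|a u IH] z; first exact: holds_is_symbol.
rewrite [RHS]/= -holds_is_symbol [reading _]/= holds_and holds_all.
congr (_ && _); apply/forallP/idP => [|H v].
  move=> /(_ (z 5 + 1)%R); rewrite holds_imp holds_succ !eqxx implyTb holds_all.
  by move=> /forallP/(_ (z 5 + 1)%R); rewrite holds_imp holds_same !eqxx implyTb
    IH.
rewrite holds_imp holds_succ holds_all; apply/implyP=> /eqP Ev;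
  apply/forallP=> v'; rewrite holds_imp holds_same IH.
by apply/implyP => /= /eqP <-; rewrite Ev.
Qed.

Lemma holds_input_row tab z u : holds (tiling_rel tab) z (input_row u) =
  reads (fun p => proj (tab (0%R, p))) 0%R bl u.
Proof.
rewrite /input_row holds_all; apply/forallP/idP => [/(_ 0%R)|H t].
  by rewrite holds_all => /forallP/(_ 0%R);
    rewrite !holds_imp !holds_zero holds_reading !eqxx.
rewrite holds_all; apply/forallP=> p; rewrite !holds_imp !holds_zero
  holds_reading /=.
by apply/implyP=> /eqP->; apply/implyP=> /eqP->.
Qed.

Definition tiling_ok (u : seq X) (tab : tiling) : bool :=
  [forall t : Z, forall p : Z,
     W (t == 0)%R (t + 1 == 0)%R (p == 0)%R
       (tab (t, p - 1)%R) (tab (t, p)) (tab (t, p + 1)%R) (tab (t + 1, p)%R)] &&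
  reads (fun p => proj (tab (0, p)%R)) 0%R bl u.

Notation tau := vocabulary_of.

Lemma size_tau : size tau = #|G|.+1.
Proof. by rewrite /= size_nseq. Qed.

Definition model_rel (v : 'I_2) (tab : tiling) (r : nat) (d : seq 'I_2) : bool
  :=
  if r == 0 then d == [:: v]
  else tiling_rel tab r (code m v (take m d)) (code m v (drop m d)).

Definition model_of (v : 'I_2) (tab : tiling) : structure tau 'I_2 :=
  [ffun r : 'I_(size tau) =>
     [set d : (nth 0 tau r).-tuple 'I_2 | model_rel v tab r d]].

Lemma model_of_mem v tab r d : r < size tau -> size d = nth 0 tau r ->
  rel_mem (model_of v tab) r d = model_rel v tab r d.
Proof.
move=> lt_r sd; rewrite /rel_mem insubT ffunE; apply/existsP/idP => [[t]|H].
  by rewrite inE => /andP[Ht /eqP <-].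
have sz : size d == nth 0 tau (Sub r lt_r : 'I_(size tau)) by apply/eqP.
by exists (Tuple sz); rewrite inE H /=.
Qed.

Lemma model_of_unit v tab d : rel_mem (model_of v tab) 0 [:: d] = (v == d).
Proof. by rewrite model_of_mem // /model_rel /= eqseq_cons andbT eq_sym. Qed.

Lemma model_of_cell v tab r t p : 0 < r <= #|G| ->
  coded_rel (model_of v tab) v r t p = tiling_rel tab r t p.
Proof.
case: r => // r /= lt_r; have sz (z : Z) := size_tuple (decode_bits v z).
rewrite /coded_rel model_of_mem; first 1 last.
- by rewrite size_tau ltnS.
- by rewrite size_cat !sz /= nth_nseq lt_r.
by rewrite /model_rel /= take_size_cat ?drop_size_cat ?sz // !decode_bitsK.
Qed.

Lemma sat_exactly_one (S : structure tau 'I_2) e : sat S e exactly_one <->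
  exists v, forall d, rel_mem S 0 [:: d] = (v == d).
Proof.
pose U d := rel_mem S 0 [:: d].
have -> : sat S e exactly_one = [forall x : 'I_2, forall y : 'I_2,
    (x == y) || ((U x ==> ~~ U y) && (~~ U x ==> U y))].
  apply: eq_forallb => x; apply: eq_forallb => y.
  set e' := assign (assign e 0 x) 1 y.
  rewrite [LHS]/= -!/(sat S e' (Rel 0 [:: _])).
  rewrite (@sat_Rel _ _ S e' 0 [:: 0] [:: x]) //.
  by rewrite (@sat_Rel _ _ S e' 0 [:: 1] [:: y]) // (inj_eq (@Some_inj _)).
split=> [/forallP H|[v Ev]].
  exists (if U ord0 then ord0 else ord_max) => d; rewrite -/(U d).
  have /forallP/(_ ord_max)/= := H ord0.
  have [->|->] : d = ord0 \/ d = ord_max.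
    by case: d => -[|[|//]] lt_d; [left | right]; apply: val_inj.
  - by case: (U ord0).
  - by case: (U ord0) (U ord_max) => -[].
apply/forallP=> x; apply/forallP=> y; rewrite /U !Ev;
  case: (eqVneq x y) => //= xy.
have := @bit_inj v x y; case: (v == x) (v == y) => -[] // E; last first.
  by rewrite E // eqxx in xy.
by rewrite E // eqxx in xy.
Qed.

Lemma sat_sentence_of (S : structure tau 'I_2) u :
  sat S (fun=> None) (sentence_of u) <->
  exists v tab, tiling_ok u tab /\ S = model_of v tab.
Proof.
pose rho (v : 'I_2) (b : nat) := decode_bits v (0%R : Z).
(* The sentence is closed, so that the empty assignment may be replaced by a total valuation, to
   which [sat_form_of] applies. *)
have sat_val v : sat S (fun=> None) (sentence_of u) =
    sat S (valuation v (rho v)) (sentence_of u).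
  by apply: sat_free_vars => y; rewrite (negbTE (closed_sentence u y)).
have sat_And e f g : sat S e (And f g) = sat S e f && sat S e g by [].
have sem v : (forall d, rel_mem S 0 [:: d] = (v == d)) ->
    forall f, sat S (valuation v (rho v)) (form_of m f) =
      @holds m (coded_rel S v) (fun=> 0%R) f.
  move=> Ev f; rewrite (sat_form_of m0 Ev).
  suff -> : (fun b => code m v (rho v b)) = (fun=> 0%R) by [].
  by apply: functional_extensionality => b; rewrite decode_bitsK.
have tiled v tab : (forall d, rel_mem S 0 [:: d] = (v == d)) ->
    (forall r t p, 0 < r <= #|G| -> coded_rel S v r t p = tiling_rel tab r t p)
      ->
    sat S (fun=> None) (sentence_of u) = tiling_ok u tab.
  move=> Ev Er; rewrite (sat_val v) /sentence_of !sat_And !(sem v) //.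
  have -> : sat S (valuation v (rho v)) exactly_one by apply/sat_exactly_one;
    exists v.
  rewrite (holds_ext _ cells_in_unique Er) (holds_ext _ cells_in_windows Er).
  rewrite (holds_ext _ (cells_in_input u) Er) unique_cell_tiling holds_windows.
  by rewrite holds_input_row.
split=> [H|[v [tab [ok ES]]]]; last first.
  rewrite (tiled v tab) // => [d|r t p lt_r]; rewrite ES;
    first exact: model_of_unit.
  exact: model_of_cell.
have /sat_exactly_one[v Ev] : sat S (fun=> None) exactly_one.
  by move: H; rewrite sat_And => /andP[].
have [tab Etab] : exists tab : tiling, forall g t p,
    coded_rel S v (rank g) t p = tiling_rel tab (rank g) t p.
  apply: (holds_unique_cell (z := fun=> 0%R)); rewrite -sem //.
  by move: H; rewrite (sat_val v) /sentence_of !sat_And => /and3P[].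
have Er r t p : 0 < r <= #|G| -> coded_rel S v r t p = tiling_rel tab r t p.
  case: r => // r /= lt_r; have := Etab (enum_val (Ordinal lt_r)) t p.
  by rewrite /rank enum_valK.
exists v, tab; split; first by rewrite -(tiled v).
apply: structure_ext => r d lt_r sz; rewrite model_of_mem //.
case: r lt_r sz => [_|r lt_r] sz.
  by case: d sz => [|d [|]] // _; rewrite Ev /model_rel /= eqseq_cons andbT
    eq_sym.
have lt_r' : r < #|G| by rewrite -ltnS -size_tau.
have szd : size d = m + m by rewrite sz /= nth_nseq lt_r'.
have st : size (take m d) == m by rewrite size_takel // szd leq_addr.
have sd : size (drop m d) == m by rewrite size_drop szd addnK.
rewrite /model_rel /= -Er // /coded_rel.
rewrite -[take m d]/(tval (Tuple st)) -[drop m d]/(tval (Tuple sd)) !codeK //=.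
by rewrite cat_take_drop.
Qed.

(** Relation 0 reveals [v], so that the two choices of the element representing 1 never yield the
    same structure: this makes the factor 2 exact. *)
Lemma model_of_inj v tab v' tab' : model_of v tab = model_of v' tab' ->
  v = v' /\ tab = tab'.
Proof.
move=> E; have Ev : v = v'.
  by apply/eqP; rewrite eq_sym -(model_of_unit v' tab') -E model_of_unit.
split=> //; apply/ffunP=> -[t p]; apply/eqP; rewrite -eq_rank eq_sym.
have := model_of_cell v tab t p (rank_in (tab (t, p))).
rewrite E Ev model_of_cell ?rank_in // /tiling_rel eqxx => /eqP ->.
by rewrite eqxx.
Qed.

Theorem card_models u : model_count tau (sentence_of u) 2 =
  2 * #|[set tab | tiling_ok u tab]|.
Proof.
set V := [set tab | _].
have -> : 2 * #|V| = #|setX [set: 'I_2] V| by rewrite cardsX cardsT card_ord.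
rewrite /model_count.
rewrite -(card_in_imset (f := fun x => model_of x.1 x.2)); last first.
  by move=> [v tab] [v' tab'] _ _ /= /model_of_inj[-> ->].
apply: eq_card => S; rewrite inE; apply/idP/imsetP.
  move/sat_sentence_of=> [v [tab [ok ->]]]; exists (v, tab) => //.
  by rewrite !inE.
case=> -[v tab]; rewrite !inE /= => ok ->.
by apply/sat_sentence_of; exists v, tab.
Qed.

End Templates.

(** * Writing down the sentence *)

Section Emission.
Variables (A : finType) (k : nat).
Notation B := (option token).
Notation S := (tape_symbol A B).
Notation I := 'I_(last_tape k).+1.
Notation prog := (prog I S).
Notation reg := (reg k).

(** [Some] because the output is a [join], whose separator is [None]. *)
Definition token_symbols (u : seq token) : seq S :=
  map (fun t => out_symbol A (Some t)) u.
Notation tok := token_symbols.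
Definition emits (u : seq token) : prog := Emit I (tok u).

Definition times (n : nat) (P : prog) : prog := iter n (Cat P) (emits [::]).
Definition ones (r : I) : prog := For (reg 5) r (emits [:: TOne]).

(** [u] is the end of the code of the variable: [TSep], possibly preceded by
    additional units. *)
Definition var_prog (b : nat) (u : seq token) : prog :=
  Cat (times b (ones (reg 3))) (Cat (ones (reg 4)) (emits u)).
Definition first_var_prog (b : nat) : prog :=
  Cat (times b (ones (reg 3))) (emits [:: TSep]).

(** In prefix notation a conjunction nested to the right is a sequence of conjuncts, each preceded
    by [TAnd], and a final formula; so a loop can print it. *)
Definition conj_prog (r : I) (P : prog) : prog :=
  Cat (For (reg 4) r (Cat (emits [:: TAnd]) P)) (emits (enc_form true_form)).
Definition all_prog (b : nat) : prog :=
  For (reg 4) (reg 2) (Cat (emits [:: TAll]) (var_prog b [:: TSep])).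
Definition block_prog (b : nat) : prog :=
  For (reg 4) (reg 2) (var_prog b [:: TSep]).
Definition unary_prog (b : nat) : prog :=
  Cat (emits [:: TRel; TSep]) (Cat (var_prog b [:: TSep]) (emits [:: TEnd])).
Definition eq_prog (b b' : nat) (u : seq token) : prog :=
  Cat (emits [:: TEq]) (Cat (var_prog b u) (var_prog b' u)).
Definition imp_prog (P Q : prog) : prog := Cat (emits [:: TImp]) (Cat P Q).
Definition carry_prog (b b' : nat) : prog :=
  let E := eq_prog b b' [:: TOne; TSep] in
  let F := imp_prog (unary_prog b) (unary_prog b') in
  Cat (emits [:: TAnd]) (Cat (imp_prog E F) (imp_prog F E)).

Fixpoint tmpl_prog (f : tmpl) : prog :=
  match f with
  | tTrue => emits (enc_form true_form)
  | tCell r b b' => Cat (emits (TRel :: enc_nat r))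
      (Cat (block_prog b) (Cat (block_prog b') (emits [:: TEnd])))
  | tZero b => conj_prog (reg 2) (Cat (emits [:: TNeg]) (unary_prog b))
  | tSucc b b' => Cat (emits [:: TAnd; TNeg; TEq])
      (Cat (first_var_prog b) (Cat (first_var_prog b')
        (conj_prog (reg 1) (carry_prog b b'))))
  | tSame b b' => conj_prog (reg 2) (eq_prog b b' [:: TSep])
  | tNeg f => Cat (emits [:: TNeg]) (tmpl_prog f)
  | tAnd f g => Cat (emits [:: TAnd]) (Cat (tmpl_prog f) (tmpl_prog g))
  | tImp f g => Cat (emits [:: TImp]) (Cat (tmpl_prog f) (tmpl_prog g))
  | tAll b f => Cat (all_prog b) (tmpl_prog f)
  end.

Lemma reg_eq i j : i <= 5 -> j <= 5 -> (reg i == reg j) = (i == j).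
Proof. by move=> le_i le_j; rewrite -val_eqE !reg_val ?/last_tape //; lia. Qed.

Section Denotation.
Variables (m : nat) (e : I -> nat).
Hypotheses (e1 : e (reg 1) = m.-1) (e2 : e (reg 2) = m) (e3 : e (reg 3) = m).

Notation at_index v := (put_reg e (reg 4) v).

Lemma den_cat (P Q : prog) e' : den (Cat P Q) e' = den P e' ++ den Q e'.
Proof. by []. Qed.

Lemma den_cat3 (P Q R : prog) e' :
  den (Cat P (Cat Q R)) e' = den P e' ++ den Q e' ++ den R e'.
Proof. by []. Qed.

Lemma den_for x r (P : prog) e' : den (For x r P) e' =
  flatten [seq den P (put_reg e' x v) | v <- iota 0 (e' r)].
Proof. by []. Qed.

Lemma den_emits u e' : den (emits u) e' = tok u. Proof. by []. Qed.

Lemma den_times n P e' : den (times n P) e' = flatten (nseq n (den P e')).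
Proof. by elim: n => //= n ->. Qed.

Lemma den_ones r e' : den (ones r) e' = tok (nseq (e' r) TOne).
Proof.
rewrite /=; elim: (e' r) 0 => //= n IH i; by rewrite IH.
Qed.

Lemma at_index3 v : at_index v (reg 3) = m.
Proof. by rewrite /put_reg reg_eq. Qed.

Lemma at_index4 v : at_index v (reg 4) = v.
Proof. by rewrite /put_reg eqxx. Qed.

Lemma tok_cat u v : tok (u ++ v) = tok u ++ tok v. Proof. exact: map_cat. Qed.

Lemma den_times_ones b e' : e' (reg 3) = m ->
  den (times b (ones (reg 3))) e' = tok (nseq (b * m) TOne).
Proof.
move=> E; rewrite den_times den_ones E; elim: b => //= b ->.
by rewrite mulSn nseqD tok_cat.
Qed.

Lemma den_var_prog b u v :
  den (var_prog b u) (at_index v) = tok (nseq (var m b v) TOne ++ u).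
Proof.
rewrite -[LHS]/(den (times b (ones (reg 3))) (at_index v) ++
  den (ones (reg 4)) (at_index v) ++ tok u).
by rewrite den_times_ones ?at_index3 // den_ones at_index4 /var nseqD !tok_cat
  catA.
Qed.

Lemma den_var_sep b v :
  den (var_prog b [:: TSep]) (at_index v) = tok (enc_nat (var m b v)).
Proof. by rewrite den_var_prog cats1. Qed.

Lemma den_var_succ b v :
  den (var_prog b [:: TOne; TSep]) (at_index v) = tok (enc_nat (var m b v.+1)).
Proof.
by rewrite den_var_prog /enc_nat /var -cats1 addnS -addn1 [in RHS]nseqD -catA.
Qed.

Lemma den_first_var b : den (first_var_prog b) e = tok (enc_nat (var m b 0)).
Proof.
rewrite -[LHS]/(den (times b (ones (reg 3))) e ++ tok [:: TSep]).
by rewrite den_times_ones // -tok_cat cats1 /var addn0.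
Qed.

Lemma den_conj r P (F : nat -> form) n : e r = n ->
  (forall v, den P (at_index v) = tok (enc_form (F v))) ->
  den (conj_prog r P) e = tok (enc_form (conj_upto F n)).
Proof.
move=> En EP; rewrite /= En /conj_upto; elim: (iota 0 n) => //= v s IH.
by rewrite EP tok_cat -IH !catA.
Qed.

(** A block of quantifiers is a mere prefix in the code, so that the program for it need not know
    the body that follows. *)
Lemma den_all_block b f : den (all_prog b) e ++ tok (enc_form f) =
  tok (enc_form (all_block m b f)).
Proof.
rewrite /all_prog den_for e2 (eq_map (g := fun v =>
  tok (TAll :: enc_nat (var m b v)))).
  rewrite /all_block; elim: (iota 0 m) => //= v s IH.
  by rewrite tok_cat -IH -!catA.
by move=> v; rewrite den_cat den_var_sep.
Qed.

Lemma den_block b : den (block_prog b) e =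
  tok (flatten (map enc_nat (block_vars m b))).
Proof.
rewrite /block_prog den_for e2 (eq_map (g := fun v =>
  tok (enc_nat (var m b v)))).
  by rewrite /block_vars; elim: (iota 0 m) => //= v s IH; rewrite tok_cat -IH.
by move=> v; rewrite den_var_sep.
Qed.

Lemma den_unary b v : den (unary_prog b) (at_index v) =
  tok (enc_form (Rel 0 [:: var m b v])).
Proof.
rewrite /unary_prog den_cat3 den_var_sep !den_emits -!tok_cat /=.
by rewrite /enc_seq /= cats0 cats1.
Qed.

Lemma den_eq b b' v : den (eq_prog b b' [:: TSep]) (at_index v) =
  tok (enc_form (Eq (var m b v) (var m b' v))).
Proof. by rewrite /eq_prog den_cat3 !den_var_sep den_emits -!tok_cat. Qed.

Lemma den_imp P Q f g e' : den P e' = tok (enc_form f) -> den Q e' = tok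
  (enc_form g) ->
  den (imp_prog P Q) e' = tok (enc_form (Imp f g)).
Proof. by move=> EP EQ; rewrite /imp_prog den_cat3 EP EQ den_emits -!tok_cat.
  Qed.

Lemma den_carry b b' v : den (carry_prog b b') (at_index v) =
  tok (enc_form (carry_form m b b' v)).
Proof.
rewrite /carry_prog den_cat3 den_emits.
have E : den (eq_prog b b' [:: TOne; TSep]) (at_index v) =
    tok (enc_form (Eq (var m b v.+1) (var m b' v.+1))).
  by rewrite /eq_prog den_cat3 !den_var_succ den_emits -!tok_cat.
have F := den_imp (den_unary b v) (den_unary b' v).
by rewrite (den_imp E F) (den_imp F E) -!tok_cat.
Qed.

Lemma den_tmpl_prog f : den (tmpl_prog f) e = tok (enc_form (form_of m f)).
Proof.
elim: f => [|r b b'|b|b b'|b b'|f IH|f IHf g IHg|f IHf g IHg|b f IH].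
- by [].
- rewrite -[LHS]/(tok (TRel :: enc_nat r) ++ den (block_prog b) e ++
    den (block_prog b') e ++ tok [:: TEnd]).
  rewrite !den_block -!tok_cat; congr tok.
  by rewrite /= /enc_seq map_cat flatten_cat -cats1 -!catA.
- apply: den_conj => // v.
  by rewrite -[LHS]/(tok [:: TNeg] ++ den (unary_prog b) _) den_unary.
- rewrite -[LHS]/(tok [:: TAnd; TNeg; TEq] ++ den (first_var_prog b) e ++
    den (first_var_prog b') e ++ den (conj_prog (reg 1) (carry_prog b b')) e).
  rewrite !den_first_var (den_conj e1 (den_carry b b')) -!tok_cat; congr tok.
  by rewrite /= -catA.
- by apply: den_conj => // v; apply: den_eq.
- by rewrite [LHS]/= IH.
- by rewrite [LHS]/= IHf IHg -tok_cat.
- by rewrite [LHS]/= IHf IHg -tok_cat.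
by rewrite -[LHS]/(den (all_prog b) e ++ den (tmpl_prog f) e) IH den_all_block.
Qed.

End Denotation.

(** * Admissible use of the registers *)

Lemma work_cat (P Q : prog) : work_regs (Cat P Q) = work_regs P && work_regs Q.
Proof. by rewrite /work_regs /= !all_cat -!andbA; do !bool_congr. Qed.

(** Programs that may be the body of a loop with counter 4 over register 1 or 2: they avoid these
    two registers and bind only register 5. *)
Definition inner_regs (P : prog) :=
  [&& prog_ok P, all (fun r : I => 3 <= r <= 5) (regs P) &
      all (fun r => r == reg 5) (bound_regs P)].

Lemma inner_cat (P Q : prog) :
  inner_regs (Cat P Q) = inner_regs P && inner_regs Q.
Proof. by rewrite /inner_regs /= !all_cat -!andbA; do !bool_congr. Qed.

Lemma inner_cat3 (P Q R : prog) : inner_regs (Cat P (Cat Q R)) =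
  [&& inner_regs P, inner_regs Q & inner_regs R].
Proof. by rewrite !inner_cat. Qed.

Lemma reg_nat i : i <= 5 -> reg i = i :> nat.
Proof. by move=> le_i; apply: reg_val; rewrite /last_tape; lia. Qed.

Lemma inner_work P : inner_regs P -> work_regs P.
Proof.
case/and3P=> ok rP bP; rewrite /work_regs ok /=.
rewrite (sub_all _ rP) => [|r /andP[r3 r5]];
  last by rewrite r5 (ltn_trans _ r3).
by rewrite (sub_all _ bP) // => r /eqP->; rewrite reg_nat.
Qed.

Lemma inner_emits u : inner_regs (emits u). Proof. by []. Qed.

Lemma inner_ones i : 3 <= i <= 4 -> inner_regs (ones (reg i)).
Proof.
case/andP=> i3 i4; have i5 : i <= 5 by apply: ltnW.
by rewrite /inner_regs /= !reg_nat // i3 i5 !reg_eq //= !andbT; lia.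
Qed.

Lemma inner_times n P : inner_regs P -> inner_regs (times n P).
Proof. by move=> iP; elim: n => // n IH; rewrite /times iterS inner_cat iP. Qed.

Lemma inner_var b u : inner_regs (var_prog b u).
Proof. by rewrite /var_prog !inner_cat inner_times ?inner_ones. Qed.

Lemma inner_first_var b : inner_regs (first_var_prog b).
Proof. by rewrite /first_var_prog inner_cat inner_times ?inner_ones. Qed.

Lemma inner_unary b : inner_regs (unary_prog b).
Proof. by rewrite /unary_prog inner_cat3 inner_var !inner_emits. Qed.

Lemma inner_eq b b' u : inner_regs (eq_prog b b' u).
Proof. by rewrite /eq_prog inner_cat3 !inner_var inner_emits. Qed.

Lemma inner_imp P Q : inner_regs (imp_prog P Q) = inner_regs P && inner_regs Q.
Proof. by rewrite /imp_prog inner_cat3. Qed.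

Lemma inner_carry b b' : inner_regs (carry_prog b b').
Proof. by rewrite /carry_prog inner_cat3 !inner_imp !inner_unary !inner_eq. Qed.

Lemma work_for i P : 1 <= i <= 2 -> inner_regs P ->
  work_regs (For (reg 4) (reg i) P).
Proof.
case/andP=> i1 i2; have i5 : i <= 5 by lia.
move=> iP; have /and3P[ok rP bP] := inner_work iP.
case/and3P: iP => _ /allP r3 /allP b5.
have ne : 4 != i by lia.
rewrite /work_regs /= ok rP bP !reg_nat // reg_eq // i1 i5 ne /=.
rewrite !andbT; apply/andP; split.
  by apply/negP => /r3; rewrite /= reg_nat //; lia.
by apply/negP => /b5; rewrite reg_eq.
Qed.

Lemma work_conj i P : 1 <= i <= 2 -> inner_regs P -> work_regs (conj_prog (reg
  i) P).
Proof.
by move=> i12 iP; rewrite /conj_prog work_cat work_for // inner_cat iP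
  inner_emits.
Qed.

Lemma work_all_prog b : work_regs (all_prog b).
Proof. by apply: work_for => //; rewrite inner_cat inner_var inner_emits. Qed.

Lemma work_block b : work_regs (block_prog b).
Proof. by apply: work_for => //; rewrite inner_var. Qed.

Lemma work_emits u : work_regs (emits u). Proof. by []. Qed.

Lemma work_catI (P Q : prog) :
  work_regs P -> work_regs Q -> work_regs (Cat P Q).
Proof. by move=> wP wQ; rewrite work_cat wP. Qed.

Lemma work_tmpl_prog f : work_regs (tmpl_prog f).
Proof.
have wE u := work_emits u.
elim: f => [|r b b'|b|b b'|b b'|f IH|f IHf g IHg|f IHf g IHg|b f IH] //=.
- exact: work_catI (wE _) (work_catI (work_block b) (work_catI (work_block b')
  (wE _))).
- by apply: work_conj => //; rewrite inner_cat inner_unary.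
- have w1 c := inner_work (inner_first_var c).
  apply: work_catI (wE _) (work_catI (w1 b) (work_catI (w1 b') _)).
  by apply: work_conj => //; apply: inner_carry.
- by apply: work_conj => //; apply: inner_eq.
- exact: work_catI (wE _) (work_catI IHf IHg).
- exact: work_catI (wE _) (work_catI IHf IHg).
exact: work_catI (work_all_prog b) IH.
Qed.

Definition vocabulary_prog (N : nat) : prog :=
  Cat (emits [:: TOne; TSep])
    (Cat (times N (Cat (ones (reg 2)) (Cat (ones (reg 2)) (emits [:: TSep]))))
         (emits [:: TEnd])).

Lemma work_vocabulary_prog N : work_regs (vocabulary_prog N).
Proof.
have w2 : work_regs (ones (reg 2)).
  by rewrite /work_regs /= !reg_nat // reg_eq.
rewrite /vocabulary_prog !work_cat !work_emits !andbT /=.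
by elim: N => // N IH; rewrite /times iterS work_cat IH !work_cat w2.
Qed.

Lemma den_vocabulary_prog N m (e : I -> nat) : e (reg 2) = m ->
  den (vocabulary_prog N) e = tok (enc_seq (tau_of m N)).
Proof.
move=> e2; rewrite /vocabulary_prog den_cat3 !den_emits den_times den_cat3.
rewrite !den_ones e2 den_emits -!tok_cat /enc_seq /tau_of /= -cats1.
rewrite (_ : flatten (nseq N _) = tok (flatten (map enc_nat (nseq N (m + m))))).
  by rewrite tok_cat.
elim: N => //= N ->; rewrite -tok_cat; congr tok.
by rewrite /enc_nat -cats1 nseqD -!catA.
Qed.

(** * The text before, for and after the letters of the input *)

Section Sentence.
Variables (G : finType) (X : eqType) (proj : G -> X) (bl : X)
  (W : bool -> bool -> bool -> G -> G -> G -> G -> bool) (letter : A -> X).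

(** The sentence is cut just before [reading], its last subformula; nothing remains to be closed
    after it. *)
Definition prefix_prog : prog :=
  Cat (vocabulary_prog #|G|)
  (Cat (emits (TAnd :: enc_form exactly_one ++ [:: TAnd]))
  (Cat (tmpl_prog (unique_cell G))
  (Cat (emits [:: TAnd])
  (Cat (tmpl_prog (all_windows W))
  (Cat (Cat (all_prog 0) (all_prog 5))
  (Cat (emits [:: TImp]) (Cat (tmpl_prog (tZero 0))
  (Cat (emits [:: TImp]) (tmpl_prog (tZero 5)))))))))).

(** The code of [reading (a :: u')] without that of [reading u'], which is a suffix of it. Reusing
    blocks 5 and 6 makes this text the same at all positions of the input. *)
Definition letter_prog (a : A) : prog :=
  Cat (emits [:: TAnd]) (Cat (tmpl_prog (is_symbol proj (letter a)))
  (Cat (all_prog 6)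
  (Cat (emits [:: TImp]) (Cat (tmpl_prog (tSucc 5 6))
  (Cat (all_prog 5)
  (Cat (emits [:: TImp]) (tmpl_prog (tSame 6 5)))))))).

Definition suffix_prog : prog :=
  Cat (tmpl_prog (is_symbol proj bl)) (Emit I [:: out_symbol A None]).

Lemma work_prefix_prog : work_regs prefix_prog.
Proof.
have wc := work_catI; have we := work_emits; have wt := work_tmpl_prog.
have wa := work_all_prog.
exact: wc (work_vocabulary_prog _) (wc _ _ (we _) (wc _ _ (wt _) (wc _ _ (we _)
  (wc _ _ (wt _) (wc _ _ (wc _ _ (wa _) (wa _)) (wc _ _ (we _) (wc _ _ (wt _)
  (wc _ _ (we _) (wt _))))))))).
Qed.

Lemma work_letter_prog a : work_regs (letter_prog a).
Proof.
have wc := work_catI; have we := work_emits; have wt := work_tmpl_prog.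
have wa := work_all_prog.
exact: wc (we _) (wc _ _ (wt _) (wc _ _ (wa _) (wc _ _ (we _) (wc _ _ (wt _)
  (wc _ _ (wa _) (wc _ _ (we _) (wt _))))))).
Qed.

Lemma work_suffix_prog : work_regs suffix_prog.
Proof. exact: work_catI (work_tmpl_prog _) _. Qed.

Lemma den_reading m (e : I -> nat) w :
  e (reg 1) = m.-1 -> e (reg 2) = m -> e (reg 3) = m ->
  flatten [seq den (letter_prog a) e | a <- w] ++
    den (tmpl_prog (is_symbol proj bl)) e =
  tok (enc_form (form_of m (reading proj bl (map letter w)))).
Proof.
move=> e1 e2 e3; have T f := den_tmpl_prog e1 e2 e3 f.
have Al b f := den_all_block e2 e3 b f.
elim: w => [|a w IH]; first exact: T.
rewrite -[flatten _]/(den (letter_prog a) e ++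
  flatten [seq den (letter_prog a) e | a <- w]) -catA IH /letter_prog.
do 3!rewrite den_cat3; rewrite den_cat !T !den_emits.
set r := reading _ _ _.
rewrite -[form_of m (reading _ _ _)]/(And (form_of m (is_symbol proj (letter
  a)))
  (all_block m 6 (Imp (form_of m (tSucc 5 6))
    (all_block m 5 (Imp (form_of m (tSame 6 5)) (form_of m r)))))).
rewrite -[enc_form (And _ _)]/([:: TAnd] ++ enc_form (form_of m (is_symbol proj
  (letter a))) ++
  enc_form (all_block m 6 _)).
rewrite !tok_cat -!Al -[enc_form (Imp _ _)]/([:: TImp] ++ enc_form (form_of m
  (tSucc 5 6)) ++
  enc_form (all_block m 5 _)).
rewrite !tok_cat -!Al.
rewrite -[enc_form (Imp _ _)]/([:: TImp] ++ enc_form (form_of m (tSame 6 5)) ++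
  enc_form (form_of m r)).
by rewrite !tok_cat -!catA.
Qed.

Lemma den_sentence m (e : I -> nat) w :
  e (reg 1) = m.-1 -> e (reg 2) = m -> e (reg 3) = m ->
  den prefix_prog e ++ flatten [seq den (letter_prog a) e | a <- w] ++
    den suffix_prog e =
  map (@out_symbol A B) (join [:: encode (vocabulary_of G m,
    sentence_of proj bl W m (map letter w))]).
Proof.
move=> e1 e2 e3; have T f := den_tmpl_prog e1 e2 e3 f.
have Al b f := den_all_block e2 e3 b f.
set u := map letter w.
have -> : den prefix_prog e ++ flatten [seq den (letter_prog a) e | a <- w] ++
    den suffix_prog e = (den prefix_prog e ++
      tok (enc_form (form_of m (reading proj bl u)))) ++ [:: out_symbol A None].
  by rewrite /suffix_prog den_cat -(den_reading w e1 e2 e3) -!catA.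
have -> v : map (@out_symbol A B) (join [:: v]) = tok v ++ [:: out_symbol A
  None].
  by rewrite /join /= cats0 map_rcons -map_comp cats1.
congr (_ ++ _); rewrite /prefix_prog.
rewrite !(den_cat (vocabulary_prog _)) (den_vocabulary_prog _ e2) den_cat3.
set Q := Cat (emits [:: TAnd]) _.
have -> : den Q e = tok (TAnd :: enc_form (form_of m (all_windows W))) ++
    den (Cat (Cat (all_prog 0) (all_prog 5)) (Cat (emits [:: TImp])
      (Cat (tmpl_prog (tZero 0)) (Cat (emits [:: TImp]) (tmpl_prog (tZero
        5)))))) e.
  by rewrite /Q den_cat3 den_emits T.
rewrite T den_cat3 (den_cat (all_prog 0)) (den_cat3 (tmpl_prog _)) !T
  !den_emits.
have EI : (den (all_prog 0) e ++ den (all_prog 5) e) ++ tok [:: TImp] ++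
    tok (enc_form (form_of m (tZero 0))) ++ tok [:: TImp] ++
    tok (enc_form (form_of m (tZero 5))) ++
    tok (enc_form (form_of m (reading proj bl u))) =
    tok (enc_form (form_of m (input_row proj bl u))).
  rewrite -[form_of m (input_row _ _ _)]/(all_block m 0 (all_block m 5
    (Imp (form_of m (tZero 0)) (Imp (form_of m (tZero 5))
       (form_of m (reading proj bl u)))))).
  by rewrite -!Al -catA -!tok_cat.
rewrite -!catA in EI *; rewrite EI /encode /sentence_of.
rewrite -[(_, _).1]/(tau_of m #|G|) -[(_, _).2]/(And _ (And _ (And _ _))).
set f1 := form_of m _; set f2 := form_of m _; set f3 := form_of m _.
rewrite -[enc_form (And _ _)]/((TAnd :: enc_form exactly_one) ++
  (TAnd :: enc_form f1) ++ (TAnd :: enc_form f2) ++ enc_form f3).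
by rewrite -cat_cons !tok_cat -!catA.
Qed.
End Sentence.
End Emission.

(** * The reduction *)

Theorem theorem3 : sharpEXP_hard (fomc 2).
Proof.
move=> A F [M [k [timeM countM]]].
(* For T = [exp_bound k n] this choice gives 2 ^ m = 8 * T * 2 ^ n, which exceeds both 2T + 5 and n
   + T + 2 because T >= 1 and 2 ^ n > n. *)
pose extra := k + 2; pose m n := (param k extra n).+1.
pose proj (c : cell M) := c.2.1 ord0.
pose psi (w : seq A) : vocabulary * form := (vocabulary_of (cell M) (m (size
  w)),
  sentence_of proj (blank M) (@window _ M) (m (size w)) (map (@letter _ M) w)).
exists 1, ((1 / 2%:R)%:MP * 'X_ord0)%R, (fun w => [tuple encode (psi w)]);
  split.
  apply: (@transducer_ptime A (option token) k extra
    (prefix_prog A k (@window _ M)) (suffix_prog A k proj (blank M))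
    (letter_prog k proj (@letter _ M))).
  - exact: work_prefix_prog.
  - exact: work_suffix_prog.
  - exact: work_letter_prog.
  move=> w; rewrite (@den_sentence A k _ _ proj _ _ _ (m (size w))) //.
  - by rewrite /env /is_length_tape /= reg_nat.
  - by rewrite /env /is_length_tape /= reg_nat.
  - by rewrite /env /is_length_tape /= reg_nat.
move=> w; rewrite mevalM mevalC mevalXU /= tnth0 /fomc encodeK /psi.
rewrite sentence_sentence_of // card_models //.
set T := exp_bound k (size w).
have -> : #|[set tab | tiling_ok proj (blank M) (@window _ M) (m := m (size w))
    (map (@letter _ M) w) tab]| = F w.
  rewrite -countM; have T0 : 0 < T by apply: expn_gt0.
  have lt_w : size w < 2 ^ size w by apply: ltn_expl.
  have E : 2 ^ m (size w) = 8 * (T * 2 ^ size w).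
    rewrite /m /param /extra /T /exp_bound /poly_bound -expnD -(expnD 2 3).
    by congr (2 ^ _); lia.
  have [lt_T lt_n] : T.*2 + 5 < 2 ^ m (size w) /\ size w + T + 2 < 2 ^ m (size
    w).
    by rewrite E; split; nia.
  exact: (card_tableaux lt_T lt_n (timeM w)).
by rewrite natrM mulrA div1r mulVf // mul1r.
Qed.
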